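(* Let $\Omega\subset\mathbb{C}$ be a non-empty connected open set, let $X\hookrightarrow \mathrm{Hol}(\Omega)$ be a Banach space of holomorphic functions satisfying the evaluation condition $(E)$, let $G\in \mathrm{Hol}(\Omega)$, and let $\varphi$ be the semiflow generated by $G$. Let $T$ be a $C_0$-semigroup on $X$ with generator $A$. Assume that $Af=Gf'$ for all $f\in D(A)$. Then the semiflow $\varphi$ is global and $$(T(t)f)(z)=f(\varphi(t,z))$$ for all $f\in X$, $t\geq 0$, $z\in\Omega$. Moreover the domain of $A$ is maximal, i.e. $A$ is given by $$D(A)=\{f\in X: Gf'\in X\},\qquad Af=Gf'.$$
   Context: $\mathrm{Hol}(\Omega)$ is the Fréchet space of all holomorphic functions $\Omega\to\mathbb{C}$ (uniform convergence on compact sets). $X\hookrightarrow\mathrm{Hol}(\Omega)$ (a Banach space of holomorphic functions) means: $X$ is a linear subspace of $\mathrm{Hol}(\Omega)$ which is a complex Banach space for its own norm $\|\cdot\|_X$, and for every $z\in\Omega$ the evaluation $\delta_z: f\mapsto f(z)$ is a bounded linear functional on $X$ (equivalently, the embedding of $X$ in $\mathrm{Hol}(\Omega)$ is continuous). Evaluation condition $(E)$: if $(z_n)$ is a sequence in $\Omega$ such that $z_n\to z\in\overline{\Omega}\cup\{\infty\}$ (convergence in the one-point compactification $\mathbb{C}\cup\{\infty\}$) and $\lim_{n\to\infty}f(z_n)$ exists in $\mathbb{C}$ for all $f\in X$, then $z\in\Omega$. Semiflow generated by $G$: for $z\in\Omega$, $\varphi(\cdot,z):[0,\tau(z))\to\Omega$,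 with $0<\tau(z)\le\infty$, is the unique maximal (forward in time) solution of the initial value problem $u'(t)=G(u(t))$, $u(0)=z$. The semiflow is called global if $\tau(z)=\infty$ for all $z\in\Omega$. *)

(* Defs.v *)
From Stdlib Require Import Reals.
From Coquelicot Require Import Coquelicot.

Open Scope R_scope.

Definition connected (D : C -> Prop) : Prop :=
  forall U V : C -> Prop,
    open U -> open V ->
    (forall z, D z -> U z \/ V z) ->
    (forall z, D z -> ~ (U z /\ V z)) ->
    (exists z, D z /\ U z) -> ~ (exists z, D z /\ V z).

(* Functions on [Omega] are represented by total functions [C -> C] whose
   values outside [Omega] are irrelevant. *)
Definition holomorphic (Omega : C -> Prop) (f : C -> C) : Prop :=
  forall z, Omega z -> @ex_derive C_AbsRing C_NormedModule f z.

(* X as a linear subspace of Hol(Omega) with its own complete norm: an abstract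
   complex Banach space [X] together with the map [ev] reading an element of [X]
   as a function.  [ev] is a linear injection into the holomorphic functions on
   [Omega]; [is_linear] includes the boundedness of the functional. *)
Record banach_of_holomorphic (Omega : C -> Prop)
    (X : CompleteNormedModule C_AbsRing) (ev : X -> C -> C) : Prop := {
  ev_holomorphic : forall f, holomorphic Omega (ev f);
  ev_injective : forall f g,
    (forall z, Omega z -> ev f z = ev g z) -> f = g;
  ev_bounded_linear : forall z, Omega z ->
    @is_linear C_AbsRing X C_NormedModule (fun f => ev f z)
}.

(* Points of the one-point compactification of C: [None] is infinity. *)
Definition sphere_lim (zn : nat -> C) (z : option C) : Prop :=
  match z with
  | Some w => filterlim zn eventually (locally w)
  | None => is_lim_seq (fun n => Cmod (zn n)) p_infty
  end.

Definition closure_or_infinity (Omega : C -> Prop) (z : option C) : Prop :=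
  match z with
  | Some w => forall eps : posreal, exists y, Omega y /\ ball w eps y
  | None => True
  end.

Definition evaluation_condition (Omega : C -> Prop)
    {X : CompleteNormedModule C_AbsRing} (ev : X -> C -> C) : Prop :=
  forall (zn : nat -> C) (z : option C),
    (forall n, Omega (zn n)) ->
    closure_or_infinity Omega z ->
    sphere_lim zn z ->
    (forall f : X, exists l : C,
      filterlim (fun n => ev f (zn n)) eventually (locally l)) ->
    exists w, z = Some w /\ Omega w.

(* [u] restricted to [0, tau) solves u' = G(u), u(0) = z in [Omega].  The
   derivative is taken within [0, +oo), hence is one-sided at 0. *)
Definition solution (Omega : C -> Prop) (G : C -> C) (z : C)
    (tau : Rbar) (u : R -> C) : Prop :=
  Rbar_lt 0 tau /\ u 0 = z /\
  forall t : R, 0 <= t -> Rbar_lt t tau ->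
    Omega (u t) /\
    @filterdiff R_AbsRing R_NormedModule C_R_NormedModule u
      (within (fun s => 0 <= s) (locally t)) (fun h => @scal R_Ring C_R_ModuleSpace h (G (u t))).

Definition maximal_solution (Omega : C -> Prop) (G : C -> C) (z : C)
    (tau : Rbar) (u : R -> C) : Prop :=
  solution Omega G z tau u /\
  forall (tau' : Rbar) (v : R -> C),
    solution Omega G z tau' v ->
    Rbar_le tau tau' ->
    (forall t : R, 0 <= t -> Rbar_lt t tau -> v t = u t) ->
    tau' = tau.

Definition semiflow_generated (Omega : C -> Prop) (G : C -> C)
    (tau : C -> Rbar) (phi : R -> C -> C) : Prop :=
  forall z, Omega z -> maximal_solution Omega G z (tau z) (fun t => phi t z).

Definition global (Omega : C -> Prop) (tau : C -> Rbar) : Prop :=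
  forall z, Omega z -> tau z = p_infty.

(* Only the values [T t] with [0 <= t] are meaningful. *)
Record C0_semigroup {X : CompleteNormedModule C_AbsRing}
    (T : R -> X -> X) : Prop := {
  C0_bounded_linear : forall t, 0 <= t -> @is_linear C_AbsRing X X (T t);
  C0_zero : forall f, T 0 f = f;
  C0_plus : forall s t f, 0 <= s -> 0 <= t -> T (s + t) f = T s (T t f);
  C0_continuous : forall f,
    filterlim (fun t => T t f) (at_right 0) (locally f)
}.

Definition generator_lim {X : CompleteNormedModule C_AbsRing}
    (T : R -> X -> X) (f g : X) : Prop :=
  filterlim (fun t : R => scal (RtoC (/ t) : C_AbsRing) (minus (T t f) f))
    (at_right 0) (locally g).

(* The unbounded operator [A] with domain [DA]; the values of [A] outside [DA]
   are irrelevant. *)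
Definition is_generator {X : CompleteNormedModule C_AbsRing}
    (T : R -> X -> X) (DA : X -> Prop) (A : X -> X) : Prop :=
  (forall f, DA f <-> exists g, generator_lim T f g) /\
  (forall f, DA f -> generator_lim T f (A f)).

(* [g = G f'] on [Omega].  [C_derive] is a total operator, which agrees with the
   complex derivative for functions differentiable at the given point. *)
Definition eq_G_derive (Omega : C -> Prop) (G f g : C -> C) : Prop :=
  forall z, Omega z -> g z = (G z * C_derive f z)%C.

(* Main.v *)
Require Import Defs.
From Stdlib Require Import Reals Lra Lia ClassicalEpsilon.
From Coquelicot Require Import Coquelicot.

(** Let [u] be a solution of [u' = G u] starting at [z].  For [f] in the domain
    of the generator the function [s |-> (T (t - s) f) (u s)] is constant: its
    derivative is [- (A T (t - s) f) (u s) + G (u s) * (T (t - s) f)' (u s)],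
    which vanishes because [A] acts as [G d/dz]
    ([semigroup_eq_composition_on_domain]).  Comparing [s = 0] and [s = t] gives
    [(T t f) z = f (u t)] as long as the solution lives; both sides are bounded
    functionals of [f], so density of the domain yields the identity on all of
    [X] ([semigroup_eq_composition]).

    The solution cannot stop at a finite time [b].  For any [s n] increasing to
    [b] the values [f (u (s n)) = (T (s n) f) z] converge to [(T b f) z] for all
    [f], so every cluster point of [u (s n)] on the sphere lies in [Omega] by the
    evaluation condition ([maximal_solution_global]).  But a solution that
    clusters at [w] in [Omega] converges to [w], since its speed is bounded near
    [w], and it can then be continued by the solution issued from [w]
    ([maximal_solution_no_limit]).

    For maximality of the domain let [g = G f'] with [f] and [g] in [X].  Then
    [s |-> f (u s)] has derivative [g (u s) = (T s g) z], hence
    [T t f - f = int_0^t T s g ds], which characterizes [f] being in the domain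
    with value [g] ([has_generator_value_iff],
    [generator_lim_of_eq_G_derive]).

    Two instances of uniform boundedness make the differentiation under the
    evaluation legitimate: the operators [T t] are bounded uniformly for small
    [t], and the evaluations at [w] are bounded uniformly for [w] near a point of
    [Omega].  Both come from [banach_steinhaus_near].  The calculus is done over
    the reals, on [X] with its scalars restricted. *)

Open Scope R_scope.

(** * Identities in groups and norms *)

Lemma norm_scal_R {V : NormedModule R_AbsRing} (l : R) (x : V) :
  norm (scal l x) = Rabs l * norm x.
Proof.
  apply Rle_antisym; [exact (norm_scal l x)|].
  destruct (Req_dec l 0) as [->|Hl].
  { rewrite Rabs_R0, Rmult_0_l. apply norm_ge_0. }
  assert (H : norm x <= Rabs (/ l) * norm (scal l x)).
  { replace x with (scal (/ l) (scal l x)) at 1.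
    - exact (norm_scal (/ l) (scal l x)).
    - rewrite scal_assoc. change (mult (/ l) l) with (/ l * l).
      rewrite Rinv_l by easy. exact (scal_one x). }
  rewrite Rabs_inv in H.
  apply Rmult_le_reg_l with (/ Rabs l).
  { apply Rinv_0_lt_compat, Rabs_pos_lt, Hl. }
  rewrite <- Rmult_assoc, Rinv_l, Rmult_1_l; [exact H|].
  apply Rabs_no_R0, Hl.
Qed.

Lemma eq_of_minus_zero {V : AbelianGroup} (x y : V) :
  minus x y = zero -> x = y.
Proof.
  intros H. apply plus_reg_r with (opp y). rewrite plus_opp_r. exact H.
Qed.

Lemma minus_def {V : AbelianGroup} (x y : V) : minus x y = plus x (opp y).
Proof. reflexivity. Qed.

Lemma minus_minus_swap {V : AbelianGroup} (a b c d : V) :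
  minus (minus a b) (minus c d) = minus (minus a c) (minus b d).
Proof.
  rewrite !minus_def, !opp_plus, !opp_opp, <- !plus_assoc. f_equal.
  rewrite !plus_assoc. f_equal. apply plus_comm.
Qed.

Lemma plus_minus_l {V : AbelianGroup} (x y : V) : plus (minus x y) y = x.
Proof. rewrite minus_def, <- plus_assoc, plus_opp_l. apply plus_zero_r. Qed.

Lemma minus_plus_l {V : AbelianGroup} (x y : V) : minus (plus x y) x = y.
Proof. rewrite minus_def, (plus_comm x), <- plus_assoc, plus_opp_r. apply plus_zero_r. Qed.

Lemma minus_minus_l {V : AbelianGroup} (x y : V) : minus (minus x y) x = opp y.
Proof. apply (minus_plus_l x (opp y)). Qed.

Lemma minus_plus_minus {V : AbelianGroup} (x y : V) :
  minus (plus x y) (minus x y) = plus y y.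
Proof.
  rewrite !minus_def, opp_plus, opp_opp, (plus_comm x y), <- plus_assoc.
  rewrite (plus_assoc x), plus_opp_r, plus_zero_l. reflexivity.
Qed.

Lemma eq_minus_of_minus_eq_zero_minus {V : AbelianGroup} (x y z : V) :
  minus x y = minus zero z -> x = minus y z.
Proof.
  intros H. rewrite <- (plus_minus_l x y), H, !minus_def, plus_zero_l. apply plus_comm.
Qed.

Lemma minus_eq_of_minus_eq_minus_zero {V : AbelianGroup} (x y z : V) :
  minus x y = minus z zero -> minus x z = y.
Proof.
  intros H. rewrite <- (plus_minus_l x y), H, minus_zero_r. apply minus_plus_l.
Qed.

Lemma norm_minus_triangle {K : AbsRing} {V : NormedModule K} (x y z : V) :
  norm (minus x z) <= norm (minus x y) + norm (minus y z).
Proof. rewrite (minus_trans y x z). apply (norm_triangle (minus x y) (minus y z)). Qed.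

Lemma norm_le_minus_plus {K : AbsRing} {V : NormedModule K} (x y : V) :
  norm x <= norm (minus x y) + norm y.
Proof.
  rewrite <- (plus_minus_l x y) at 1. apply (norm_triangle (minus x y) y).
Qed.

Lemma norm_minus_sym {K : AbsRing} {V : NormedModule K} (x y : V) :
  norm (minus x y) = norm (minus y x).
Proof. rewrite <- norm_opp, opp_minus. reflexivity. Qed.

Lemma norm_minus_self {K : AbsRing} {V : NormedModule K} (x : V) :
  norm (minus x x) = 0.
Proof. rewrite (minus_eq_zero x). apply norm_zero. Qed.

(** * Increments of vector-valued functions *)

Lemma continuous_norm_near {V : NormedModule R_AbsRing} (v : R -> V) (s : R) :
  continuous v s -> forall eps, 0 < eps ->
  exists delta : posreal, forall r, Rabs (r - s) < delta -> norm (minus (v r) (v s)) < eps.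
Proof.
  intros Hv eps Heps.
  destruct (proj1 (filterlim_locally_ball_norm v (v s)) Hv (mkposreal eps Heps)) as [d Hd].
  exists d. intros r Hr. exact (Hd r Hr).
Qed.

Lemma is_derive_near {V : NormedModule R_AbsRing} (v : R -> V) (s : R) (l : V) :
  is_derive v s l -> forall eps, 0 < eps ->
  exists delta : posreal, forall r, Rabs (r - s) < delta ->
    norm (minus (minus (v r) (v s)) (scal (r - s) l)) <= eps * Rabs (r - s).
Proof.
  intros [_ Hv] eps Heps.
  destruct (Hv s (fun P H => H) (mkposreal eps Heps)) as [d Hd].
  exists d. intros r Hr. exact (Hd r Hr).
Qed.

Lemma is_derive_lipschitz_near {V : NormedModule R_AbsRing} (v : R -> V) (s : R) (l : V) M :
  is_derive v s l -> norm l < M ->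
  exists delta : posreal, forall r, Rabs (r - s) < delta ->
    norm (minus (v r) (v s)) <= M * Rabs (r - s).
Proof.
  intros Hv Hl.
  destruct (is_derive_near v s l Hv (M - norm l)) as [d Hd]; [lra|].
  exists d. intros r Hr. specialize (Hd r Hr).
  assert (H := norm_le_minus_plus (minus (v r) (v s)) (scal (r - s) l)).
  rewrite norm_scal_R in H. nra.
Qed.

(** Real induction: the times up to which the bound holds form a closed set by
    continuity, and the local hypothesis pushes the supremum further.  The local
    bound may use that the bound holds up to [s], so that hypotheses on the
    derivative are only needed where the curve has not yet escaped. *)
Lemma norm_increment_le {V : NormedModule R_AbsRing} (v : R -> V) (M a b : R) :
  a <= b -> 0 <= M ->
  (forall s, a <= s <= b -> continuous v s) ->
  (forall s, a <= s < b -> norm (minus (v s) (v a)) <= M * (s - a) ->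
     exists delta : posreal, forall r, s < r < s + delta ->
       norm (minus (v r) (v s)) <= M * (r - s)) ->
  norm (minus (v b) (v a)) <= M * (b - a).
Proof.
  intros Hab HM Hc Hstep.
  set (E := fun s => a <= s <= b /\
    forall r, a <= r <= s -> norm (minus (v r) (v a)) <= M * (r - a)).
  assert (Ea : E a).
  { split; [lra|]. intros r Hr. replace r with a by lra.
    rewrite norm_minus_self. lra. }
  destruct (completeness E) as [c [Hub Hlub]].
  { exists b. intros s [Hs _]. lra. }
  { exists a. exact Ea. }
  assert (Hac : a <= c) by (apply Hub, Ea).
  assert (Hcb : c <= b) by (apply Hlub; intros s [Hs _]; lra).
  assert (Hnear : forall e, 0 < e -> exists s, E s /\ c - e < s <= c).
  { intros e He. apply NNPP. intros Hn.
    assert (c <= c - e); [|lra].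
    apply Hlub. intros s Hs. destruct (Rle_dec s (c - e)) as [H|H]; [exact H|].
    exfalso. apply Hn. exists s. split; [exact Hs|]. split; [lra|apply Hub, Hs]. }
  assert (Hcc : norm (minus (v c) (v a)) <= M * (c - a)).
  { apply le_epsilon. intros e He.
    destruct (continuous_norm_near v c (Hc c (conj Hac Hcb)) e He) as [d Hd].
    destruct (Hnear d (cond_pos d)) as [s [[Hs1 Hs2] Hs3]].
    assert (H1 := Hs2 s ltac:(lra)).
    assert (H2 := Hd s ltac:(rewrite Rabs_minus_sym, Rabs_pos_eq; lra)).
    rewrite norm_minus_sym in H2.
    assert (H3 := norm_minus_triangle (v c) (v s) (v a)). nra. }
  destruct (Req_dec c b) as [<-|Hne]; [exact Hcc|exfalso].
  destruct (Hstep c ltac:(lra) Hcc) as [d Hd].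
  set (e := Rmin (d / 2) (b - c)).
  assert (He : 0 < e /\ e <= b - c /\ e < d).
  { unfold e. assert (Hdp := cond_pos d).
    split; [apply Rmin_pos; lra|]. split; [apply Rmin_r|].
    apply Rle_lt_trans with (d / 2); [apply Rmin_l|lra]. }
  assert (H : E (c + e)); [|apply Hub in H; lra].
  split; [lra|]. intros r Hr.
  destruct (Rle_dec r c) as [Hrc|Hrc].
  - destruct (Req_dec r c) as [->|Hrc']; [exact Hcc|].
    destruct (Hnear (c - r) ltac:(lra)) as [s [[_ Hs2] Hs3]]. apply Hs2. lra.
  - assert (H1 := Hd r ltac:(lra)).
    assert (H2 := norm_minus_triangle (v r) (v c) (v a)). lra.
Qed.

(** A curve whose speed is below [M] as long as it stays in the ball of radius
    [rho] around [w] has no time to leave that ball during [[a, b]]. *)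
Lemma norm_increment_trapped {V : NormedModule R_AbsRing} (v : R -> V) (w : V) (rho M a b : R) :
  a <= b -> 0 <= M ->
  (forall s, a <= s <= b -> continuous v s) ->
  (forall s, a <= s < b -> norm (minus (v s) w) < rho ->
     exists l, is_derive v s l /\ norm l < M) ->
  norm (minus (v a) w) + M * (b - a) < rho ->
  norm (minus (v b) (v a)) <= M * (b - a).
Proof.
  intros Hab HM Hc Hd Hrho. apply norm_increment_le; try assumption.
  intros s Hs Hsa.
  destruct (Hd s Hs) as [l [Hl1 Hl2]].
  { assert (H := norm_minus_triangle (v s) (v a) w). nra. }
  destruct (is_derive_lipschitz_near v s l M Hl1 Hl2) as [d H].
  exists d. intros r Hr. specialize (H r).
  rewrite Rabs_pos_eq in H by lra. apply H. lra.
Qed.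

(** [norm_increment_le] needs some slack [M' > M] in the speed and a derivative at
    the left end point; both are recovered in the limit [M' -> M], [a' -> a]. *)
Lemma mean_value_inequality {V : NormedModule R_AbsRing} (v : R -> V) (M a b : R) :
  a <= b -> 0 <= M ->
  (forall s, a <= s <= b -> continuous v s) ->
  (forall s, a < s < b -> exists l, is_derive v s l /\ norm l <= M) ->
  norm (minus (v b) (v a)) <= M * (b - a).
Proof.
  intros Hab HM Hc Hd.
  destruct (Req_dec a b) as [<-|Hne]; [rewrite norm_minus_self; lra|].
  apply le_epsilon. intros e He.
  destruct (continuous_norm_near v a (Hc a ltac:(lra)) (e / 2) ltac:(lra)) as [d Hda].
  set (k := Rmin (d / 2) ((b - a) / 2)).
  assert (Hk : 0 < k /\ k < b - a /\ k < d).
  { unfold k. assert (Hdp := cond_pos d). split; [apply Rmin_pos; lra|].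
    split; [eapply Rle_lt_trans; [apply Rmin_r|lra]|
            eapply Rle_lt_trans; [apply Rmin_l|lra]]. }
  assert (H1 := Hda (a + k) ltac:(rewrite Rabs_pos_eq; lra)).
  set (M' := M + e / (2 * (b - a))).
  assert (HM' : M < M' /\ (M' - M) * (b - a) = e / 2).
  { unfold M'. split; [|field; lra].
    assert (0 < e / (2 * (b - a))) by (apply Rdiv_lt_0_compat; lra). lra. }
  assert (H2 : norm (minus (v b) (v (a + k))) <= M' * (b - (a + k))).
  { apply norm_increment_le; [lra|lra|intros; apply Hc; lra|].
    intros s Hs _. destruct (Hd s ltac:(lra)) as [l [Hl1 Hl2]].
    destruct (is_derive_lipschitz_near v s l M' Hl1 ltac:(lra)) as [d' H].
    exists d'. intros r Hr. specialize (H r).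
    rewrite Rabs_pos_eq in H by lra. apply H. lra. }
  assert (H3 := norm_minus_triangle (v b) (v (a + k)) (v a)). nra.
Qed.

Lemma constant_of_is_derive_zero {V : NormedModule R_AbsRing} (v : R -> V) (a b : R) :
  a <= b ->
  (forall s, a <= s <= b -> continuous v s) ->
  (forall s, a < s < b -> is_derive v s zero) ->
  v b = v a.
Proof.
  intros Hab Hc Hd.
  assert (H := mean_value_inequality v 0 a b Hab (Rle_refl 0) Hc).
  rewrite Rmult_0_l in H.
  apply eq_of_minus_zero, norm_eq_zero, Rle_antisym; [|apply norm_ge_0]. apply H.
  intros s Hs. exists zero. split; [apply Hd, Hs|]. rewrite norm_zero. lra.
Qed.

(** The mean value inequality for [s |-> v s - s * g c], whose derivative
    [g s - g c] is small near [c], shows that a derivative which extends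
    continuously to [c] is the derivative there.  This is what glues two solutions
    of a differential equation at a common end point. *)
Lemma is_derive_extend {V : NormedModule R_AbsRing} (v g : R -> V) (c : R) :
  locally c (fun s => continuous v s) ->
  locally c (fun s => s <> c -> is_derive v s (g s)) ->
  continuous g c ->
  is_derive v c (g c).
Proof.
  intros Hv Hd Hg. split; [apply is_linear_scal_l|].
  intros x Hx. apply (@is_filter_lim_locally_unique _ R_NormedModule) in Hx. subst x. intros [e He].
  destruct Hv as [d1 Hv], Hd as [d2 Hd].
  destruct (continuous_norm_near g c Hg e He) as [d3 Hg'].
  set (d := Rmin d1 (Rmin d2 d3)).
  assert (Hdp : 0 < d).
  { apply Rmin_pos; [apply cond_pos|apply Rmin_pos; apply cond_pos]. }
  assert (Hd1 : d <= d1) by apply Rmin_l.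
  assert (Hd2 : d <= d2) by (eapply Rle_trans; [apply Rmin_r|apply Rmin_l]).
  assert (Hd3 : d <= d3) by (eapply Rle_trans; [apply Rmin_r|apply Rmin_r]).
  set (k := (fun s => minus (v s) (scal s (g c))) : R -> V).
  assert (Hlin : forall s, is_derive (fun s : R => scal s (g c)) s (g c)).
  { intros s. apply filterdiff_linear, is_linear_scal_l. }
  assert (Hkc : forall s, Rabs (s - c) < d -> continuous k s).
  { intros s Hs. apply (continuous_minus (V := V)); [apply Hv; eapply Rlt_le_trans; [exact Hs|exact Hd1]|].
    exact (ex_derive_continuous (fun s : R => scal s (g c)) s (ex_intro _ _ (Hlin s))). }
  assert (Hkd : forall s, s <> c -> Rabs (s - c) < d ->
    exists l, is_derive k s l /\ norm l <= e).
  { intros s Hsc Hs. exists (minus (g s) (g c)). split.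
    - apply (is_derive_minus v (fun s : R => scal s (g c))); [|apply Hlin].
      apply Hd; [eapply Rlt_le_trans; [exact Hs|exact Hd2]|exact Hsc].
    - apply Rlt_le, Hg'. lra. }
  assert (Hinc : forall a b, a <= b -> (a = c \/ b = c) ->
    Rabs (a - c) < d -> Rabs (b - c) < d ->
    norm (minus (k b) (k a)) <= e * (b - a)).
  { intros a b Hab Hor Ha Hb. apply Rabs_def2 in Ha. apply Rabs_def2 in Hb.
    apply mean_value_inequality; [exact Hab|lra| |].
    - intros s Hs. apply Hkc, Rabs_def1; lra.
    - intros s Hs. apply Hkd; [lra|]. apply Rabs_def1; lra. }
  exists (mkposreal d Hdp). intros s Hs. change (Rabs (s - c) < d) in Hs.
  change (norm (minus (minus (v s) (v c)) (scal (s - c) (g c))) <= e * Rabs (s - c)).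
  replace (minus (minus (v s) (v c)) (scal (s - c) (g c))) with (minus (k s) (k c)).
  2:{ unfold k. replace (scal (s - c) (g c)) with (minus (scal s (g c)) (scal c (g c))).
      - apply minus_minus_swap.
      - symmetry. exact (scal_minus_distr_r s c (g c)). }
  assert (Hc0 : Rabs (c - c) < d) by (rewrite Rminus_diag, Rabs_R0; exact Hdp).
  destruct (Rle_dec c s) as [H|H].
  - rewrite Rabs_pos_eq by lra. apply Hinc; auto.
  - rewrite Rabs_minus_sym, Rabs_pos_eq, norm_minus_sym by lra. apply Hinc; auto; lra.
Qed.

(** * Uniform boundedness *)

(** A linear map that is large somewhere is large at a point of every ball: the
    values at [x + y] and [x - y] cannot both be smaller than the value at [y]. *)
Lemma norm_linear_large_on_ball {V W : NormedModule R_AbsRing} (L : V -> W) (K : R)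
    (x : V) (r : posreal) :
  is_linear L -> 0 <= K ->
  (exists y, K * norm y < norm (L y)) ->
  exists x', norm (minus x' x) <= r /\ K * r <= norm (L x').
Proof.
  intros HL HK [y Hy].
  assert (Hy0 : 0 < norm y).
  { destruct (norm_ge_0 y) as [H|H]; [exact H|exfalso].
    apply eq_sym, norm_eq_zero in H. subst y.
    rewrite (linear_zero L HL) in Hy. rewrite !norm_zero in Hy. lra. }
  set (y' := scal (r / norm y) y).
  assert (Hc : 0 < r / norm y) by (apply Rdiv_lt_0_compat; [apply cond_pos|exact Hy0]).
  assert (Hy1 : norm y' = r).
  { unfold y'. rewrite norm_scal_R, Rabs_pos_eq by lra. field. lra. }
  assert (Hy2 : K * r <= norm (L y')).
  { unfold y'. rewrite (linear_scal L HL), norm_scal_R, Rabs_pos_eq by lra.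
    replace (K * r) with (r / norm y * (K * norm y)) by (field; lra).
    apply Rmult_le_compat_l; lra. }
  (* L y' is half the difference of L (x + y') and L (x - y') *)
  assert (H : norm (scal 2 (L y')) <= norm (L (plus x y')) + norm (L (minus x y'))).
  { replace (scal 2 (L y')) with (minus (L (plus x y')) (L (minus x y'))).
    - eapply Rle_trans; [apply (norm_triangle (L (plus x y')) (opp (L (minus x y'))))|].
      rewrite norm_opp. apply Rle_refl.
    - rewrite <- (linear_minus L _ _ HL), <- (linear_scal L HL). f_equal.
      etransitivity; [apply (minus_plus_minus x y')|].
      assert (H := scal_distr_r (1 : R_Ring) 1 y').
      rewrite (scal_one y' : scal 1 y' = y') in H. symmetry. exact H. }
  rewrite norm_scal_R, Rabs_pos_eq in H by lra.
  destruct (Rle_dec (K * r) (norm (L (plus x y')))) as [H1|H1].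
  - exists (plus x y'). split; [|exact H1].
    replace (minus (plus x y') x) with y' by (symmetry; apply (minus_plus_l x y')). lra.
  - exists (minus x y'). split; [|lra].
    assert (H2 : norm (minus (minus x y') x) = norm y').
    { rewrite <- (norm_opp y'). f_equal. apply (minus_minus_l x y'). }
    lra.
Qed.

Lemma nested_balls {V : CompleteNormedModule R_AbsRing} (c : nat -> V) (r : nat -> posreal) :
  (forall n, r (S n) <= r n / 2) ->
  (forall n, norm (minus (c (S n)) (c n)) <= r n / 2) ->
  exists x, forall n, norm (minus x (c n)) <= r n.
Proof.
  intros Hr Hc.
  pose (d := fun x y : V => norm (minus x y)).
  assert (Hself : forall x, d x x = 0) by exact norm_minus_self.
  assert (Hsym : forall x y, d x y = d y x) by exact norm_minus_sym.
  assert (Htri : forall x y z, d x z <= d x y + d y z) by exact norm_minus_triangle.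
  assert (Hball : forall x y eps, d y x < eps -> ball x eps y) by exact norm_compat1.
  assert (Hlim : forall (x : V) (e : posreal), filterlim c eventually (locally x) ->
    eventually (fun n => d (c n) x < e)).
  { intros x e Hx.
    exact (proj1 (filterlim_locally_ball_norm (U := V) c x) Hx e). }
  change (forall n, d (c (S n)) (c n) <= r n / 2) in Hc.
  change (exists x, forall n, d x (c n) <= r n).
  clearbody d.
  assert (Hnest : forall n k, d (c (k + n)%nat) (c n) <= r n - r (k + n)%nat).
  { intros n. induction k as [|k IH]; cbn [Nat.add].
    - rewrite Hself. lra.
    - assert (H := Htri (c (S (k + n))) (c (k + n)%nat) (c n)).
      specialize (Hc (k + n)%nat). specialize (Hr (k + n)%nat). lra. }
  assert (Hnest' : forall n m, (n <= m)%nat -> d (c m) (c n) < r n).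
  { intros n m Hm. specialize (Hnest n (m - n)%nat).
    replace (m - n + n)%nat with m in Hnest by lia.
    assert (H := cond_pos (r m)). lra. }
  assert (Hr0 : forall n, r n <= r 0%nat * (/ 2) ^ n).
  { induction n as [|n IH]; simpl; [lra|]. specialize (Hr n). lra. }
  assert (Hsmall : forall e : posreal, exists n, r n < e).
  { intros e. assert (Hp := cond_pos (r 0%nat)).
    destruct (pow_lt_1_zero (/ 2) ltac:(rewrite Rabs_pos_eq; lra) (e / r 0%nat)) as [n Hn].
    { apply Rdiv_lt_0_compat; [apply cond_pos|exact Hp]. }
    exists n. specialize (Hn n (le_n n)). rewrite Rabs_pos_eq in Hn by (apply pow_le; lra).
    apply Rle_lt_trans with (1 := Hr0 n).
    apply Rmult_lt_compat_l with (r := r 0%nat) in Hn; [|exact Hp].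
    replace (r 0%nat * (e / r 0%nat)) with (pos e) in Hn by (field; lra). exact Hn. }
  destruct (proj1 (filterlim_locally_cauchy (U := V) (F := eventually) c)) as [x Hx].
  { intros e. destruct (Hsmall (pos_div_2 e)) as [n Hn].
    exists (fun m => (n <= m)%nat). split; [exists n; easy|].
    intros u v Hu Hv. apply Hball.
    apply Rle_lt_trans with (1 := Htri (c v) (c n) (c u)).
    rewrite (Hsym (c n)). assert (H1 := Hnest' n u Hu).
    assert (H2 := Hnest' n v Hv). simpl in Hn. lra. }
  exists x. intros n. apply le_epsilon. intros e He.
  destruct (Hlim x (mkposreal e He) Hx) as [N HN].
  specialize (HN (N + n)%nat ltac:(lia)). simpl in HN.
  rewrite Hsym in HN.
  assert (H1 := Htri x (c (N + n)%nat) (c n)).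
  assert (H2 := Hnest' n (N + n)%nat ltac:(lia)). lra.
Qed.

(** Gliding hump.  If no bound held near [p], there would be indices [i n] tending
    to [p] and balls, each inside the previous one, with [L (i n)] of norm at least
    [n] on the [n]-th ball.  At the common point of the balls this contradicts
    pointwise convergence.  Completeness enters through [nested_balls] only. *)
Theorem banach_steinhaus_near {U : UniformSpace} {V : CompleteNormedModule R_AbsRing}
    {W : NormedModule R_AbsRing} (L : U -> V -> W) (p : U) (D : U -> Prop) :
  (forall i, D i -> is_linear (L i)) ->
  (forall x, exists y, filterlim (fun i => L i x) (within D (locally p)) (locally y)) ->
  exists M, 0 <= M /\ within D (locally p) (fun i => forall x, norm (L i x) <= M * norm x).
Proof.
  intros HL Hpt. apply NNPP. intros Hn.
  assert (Hbig : forall (e : posreal) K, 0 <= K ->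
    exists i, ball p e i /\ D i /\ exists x, K * norm x < norm (L i x)).
  { intros e K HK. apply NNPP. intros H. apply Hn. exists K. split; [exact HK|].
    exists e. intros i Hi HD x. apply Rnot_lt_le. intros Hx. apply H.
    exists i. split; [exact Hi|]. split; [exact HD|]. exists x. exact Hx. }
  pose (good := fun (n : nat) (s : V * posreal) (t : U * (V * posreal)) =>
    let '(x, r) := s in let '(i, (x', r')) := t in
    ball p (/ (INR n + 1)) i /\ D i /\ r' <= r / 2 /\ norm (minus x' x) <= r / 2 /\
    forall y, norm (minus y x') <= r' -> INR n <= norm (L i y)).
  assert (Hstep : forall n s, exists t, good n s t).
  { intros n [x r].
    destruct (Hbig (mkposreal (/ (INR n + 1)) (RinvN_pos n)) ((INR n + 1) / (r / 2)))
      as [i [Hi [HD Hx]]].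
    { apply Rdiv_le_0_compat; [assert (H := pos_INR n); lra|apply (cond_pos (pos_div_2 r))]. }
    (* the value n + 1 at the new centre, together with a radius below 1 / M for
       some bound M of L i, leaves at least n on the whole new ball *)
    destruct (norm_linear_large_on_ball (L i) ((INR n + 1) / (r / 2)) x (pos_div_2 r)
      (HL i HD)) as [x' [Hx1 Hx2]]; [|exact Hx|].
    { apply Rdiv_le_0_compat; [assert (H := pos_INR n); lra|apply (cond_pos (pos_div_2 r))]. }
    simpl in Hx1, Hx2. assert (Hrp := cond_pos r).
    replace ((INR n + 1) / (r / 2) * (r / 2)) with (INR n + 1) in Hx2 by (field; lra).
    destruct (linear_norm (L i) (HL i HD)) as [M [HM HLM]].
    assert (Hr' : 0 < Rmin (r / 2) (/ M)).
    { apply Rmin_pos; [lra|apply Rinv_0_lt_compat, HM]. }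
    exists (i, (x', mkposreal _ Hr')). simpl. repeat split; try assumption.
    - apply Rmin_l.
    - intros y Hy.
      assert (H1 : norm (L i (minus y x')) <= 1).
      { eapply Rle_trans; [apply HLM|].
        replace 1 with (M * / M) by (field; lra). apply Rmult_le_compat_l; [lra|].
        eapply Rle_trans; [exact Hy|apply Rmin_r]. }
      rewrite (linear_minus (L i) _ _ (HL i HD)), norm_minus_sym in H1.
      assert (H2 := norm_le_minus_plus (L i x') (L i y)). lra. }
  pose (next := fun n s => proj1_sig (constructive_indefinite_description _ (Hstep n s))).
  assert (Hnext : forall n s, good n s (next n s)).
  { intros n s. apply proj2_sig. }
  pose (balls := fix balls n := match n with
    | O => (zero, mkposreal 1 Rlt_0_1) | S n => snd (next n (balls n)) end).
  pose (ind := fun n => fst (next n (balls n))).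
  assert (Hgood : forall n, good n (balls n) (ind n, balls (S n))).
  { intros n. unfold ind. simpl. rewrite <- surjective_pairing. apply Hnext. }
  clearbody ind balls. clear next Hnext Hstep Hbig Hn.
  destruct (nested_balls (fun n => fst (balls n)) (fun n => snd (balls n))) as [x Hx].
  - intros n. specialize (Hgood n). unfold good in Hgood.
    destruct (balls n), (balls (S n)). apply Hgood.
  - intros n. specialize (Hgood n). unfold good in Hgood.
    destruct (balls n), (balls (S n)). apply Hgood.
  - assert (Hi : forall n, ball p (/ (INR n + 1)) (ind n) /\ D (ind n) /\
      INR n <= norm (L (ind n) x)).
    { intros n. specialize (Hx (S n)). specialize (Hgood n). unfold good in Hgood.
      destruct (balls n) as [y r], (balls (S n)) as [y' r'].
      repeat split; try apply Hgood. exact Hx. }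
    destruct (Hpt x) as [y Hy].
    destruct (proj1 (filterlim_locally_ball_norm _ y) Hy (mkposreal 1 Rlt_0_1)) as [e He].
    destruct (nfloor_ex (Rmax (/ e) (norm y + 1))) as [n Hnn].
    { eapply Rle_trans; [|apply Rmax_l]. apply Rlt_le, Rinv_0_lt_compat, cond_pos. }
    destruct (Hi (S n)) as [H1 [H2 H3]]. rewrite S_INR in H1, H3.
    assert (H4 := Rmax_l (/ e) (norm y + 1)). assert (H5 := Rmax_r (/ e) (norm y + 1)).
    assert (H6 : norm (minus (L (ind (S n)) x) y) < 1).
    { apply (He (ind (S n))); [|exact H2].
      apply ball_le with (/ (INR n + 1 + 1)); [|exact H1].
      rewrite <- (Rinv_inv e). apply Rinv_le_contravar; [apply Rinv_0_lt_compat, cond_pos|lra]. }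
    assert (H7 := norm_le_minus_plus (L (ind (S n)) x) y). lra.
Qed.

(** * Strongly continuous semigroups *)

Lemma right_quotient_limit_iff {V : NormedModule R_AbsRing} (w : R -> V) (l : V) :
  filterlim (fun r => scal (/ r) (w r)) (at_right 0) (locally l) <->
  forall eps, 0 < eps -> exists delta : posreal, forall r, 0 < r < delta ->
    norm (minus (w r) (scal r l)) <= eps * r.
Proof.
  assert (E : forall r, 0 < r ->
    norm (minus (w r) (scal r l)) = r * norm (minus (scal (/ r) (w r)) l)).
  { intros r Hr. rewrite <- (Rabs_pos_eq r) at 3 by lra. rewrite <- norm_scal_R.
    f_equal. etransitivity; [|symmetry; apply (scal_minus_distr_l r (scal (/ r) (w r)) l)].
    f_equal. rewrite scal_assoc. change (mult r (/ r)) with (r * / r).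
    rewrite Rinv_r by lra. symmetry. apply (scal_one (w r)). }
  rewrite (filterlim_locally_ball_norm (F := at_right 0) (fun r => scal (/ r) (w r)) l).
  split.
  - intros H eps Heps. destruct (H (mkposreal eps Heps)) as [d Hd].
    exists d. intros r Hr. rewrite E by easy. rewrite Rmult_comm.
    apply Rmult_le_compat_r; [lra|]. apply Rlt_le, Hd; [|easy].
    change (Rabs (r - 0) < d). rewrite Rminus_0_r, Rabs_pos_eq; lra.
  - intros H eps. destruct (H (eps / 2)) as [d Hd].
    { apply (cond_pos (pos_div_2 eps)). }
    exists d. intros r Hr Hr0. change (Rabs (r - 0) < d) in Hr.
    rewrite Rminus_0_r, Rabs_pos_eq in Hr by lra.
    specialize (Hd r ltac:(lra)). rewrite E, Rmult_comm in Hd by lra.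
    apply Rmult_le_reg_r in Hd; [|lra]. assert (Hp := cond_pos eps).
    eapply Rle_lt_trans; [exact Hd|lra].
Qed.

Lemma is_derive_right_quotient {V : NormedModule R_AbsRing} (v : R -> V) (t : R) (l : V) :
  is_derive v t l ->
  filterlim (fun r => scal (/ r) (minus (v (t + r)) (v t))) (at_right 0) (locally l).
Proof.
  intros Hv. apply (right_quotient_limit_iff (fun r => minus (v (t + r)) (v t))).
  intros eps Heps. destruct (is_derive_near v t l Hv eps Heps) as [d Hd].
  exists d. intros r Hr. specialize (Hd (t + r)).
  replace (t + r - t) with r in Hd by ring. rewrite Rabs_pos_eq in Hd by lra.
  apply Hd. lra.
Qed.

Lemma is_derive_at_unique_of_eq_right {V : NormedModule R_AbsRing} (v w : R -> V) (t : R) (l m : V) :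
  (forall s, t <= s -> v s = w s) -> is_derive v t l -> is_derive w t m -> l = m.
Proof.
  intros Heq Hv Hw.
  apply (filterlim_locally_unique (F := at_right 0) (fun r => scal (/ r) (minus (v (t + r)) (v t)))).
  - apply is_derive_right_quotient, Hv.
  - apply filterlim_within_ext with (fun r => scal (/ r) (minus (w (t + r)) (w t))).
    + intros r Hr. rewrite !Heq by lra. reflexivity.
    + apply is_derive_right_quotient, Hw.
Qed.

Lemma is_derive_linear {V W : NormedModule R_AbsRing} (L : V -> W) (v : R -> V) (t : R) (l : V) :
  is_linear L -> is_derive v t l -> is_derive (fun s => L (v s)) t (L l).
Proof.
  intros HL Hv. apply (filterdiff_ext_lin _ (fun y : R => L (scal y l))).
  - apply (filterdiff_comp v L (fun y : R => scal y l) L); [exact Hv|].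
    apply filterdiff_linear, HL.
  - intros y. apply (linear_scal L HL).
Qed.

Lemma is_derive_shift_back {V : NormedModule R_AbsRing} (v : R -> V) (t s : R) (l : V) :
  is_derive v (t - s) l -> is_derive (fun r => v (t - r)) s (opp l).
Proof.
  intros Hv.
  assert (Hshift : is_derive (fun r => t - r) s (opp one)).
  { change (is_derive (fun r => t - r) s (-1)). auto_derive; [exact I|ring]. }
  assert (H := is_derive_comp v (fun r => t - r) s l (opp one) Hv Hshift).
  rewrite scal_opp_one in H. exact H.
Qed.

Section Semigroup.

Context {V : CompleteNormedModule R_AbsRing} (S : R -> V -> V)
  (S_linear : forall t, 0 <= t -> is_linear (S t))
  (S_zero : forall f, S 0 f = f)
  (S_plus : forall s t f, 0 <= s -> 0 <= t -> S (s + t) f = S s (S t f))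
  (S_continuous : forall f, filterlim (fun t => S t f) (at_right 0) (locally f)).

Lemma semigroup_increment f s t : 0 <= s -> 0 <= t ->
  minus (S (s + t) f) (S s f) = S s (minus (S t f) f).
Proof.
  intros Hs Ht.
  etransitivity; [|symmetry; apply (linear_minus (S s) (S t f) f (S_linear s Hs))].
  rewrite S_plus by easy. reflexivity.
Qed.

(** Strong continuity at zero is pointwise convergence along the right
    neighbourhoods of zero, to which Banach-Steinhaus applies. *)
Lemma semigroup_bounded_near_zero : exists (M : R) (d : posreal), 1 <= M /\
  forall t, 0 <= t <= d -> forall f, norm (S t f) <= M * norm f.
Proof.
  destruct (banach_steinhaus_near S 0 (fun t => 0 < t)) as [M [HM [d Hd]]].
  { intros t Ht. apply S_linear. lra. }
  { intros f. exists f. apply S_continuous. }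
  assert (Hdp := cond_pos d).
  exists (Rmax M 1), (pos_div_2 d). split; [apply Rmax_r|].
  intros t Ht f. simpl in Ht. assert (Hn := norm_ge_0 f).
  destruct (Req_dec t 0) as [->|Ht0].
  - rewrite S_zero. assert (H := Rmax_r M 1). nra.
  - apply Rle_trans with (M * norm f).
    + apply Hd; [|lra]. change (Rabs (t - 0) < d). rewrite Rminus_0_r, Rabs_pos_eq; lra.
    + apply Rmult_le_compat_r; [exact Hn|apply Rmax_l].
Qed.

(** On [[0, (n + 1) d]] the semigroup law iterates the bound [M] near zero to
    [M ^ (n + 1)]. *)
Lemma semigroup_bounded (b : R) : exists M, 1 <= M /\
  forall t, 0 <= t <= b -> forall f, norm (S t f) <= M * norm f.
Proof.
  destruct semigroup_bounded_near_zero as [M [d [HM Hd]]].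
  assert (Hdp := cond_pos d).
  assert (Hpow : forall n t, 0 <= t <= (INR n + 1) * d -> forall f,
    norm (S t f) <= M ^ (n + 1) * norm f).
  { induction n as [|n IH]; intros t Ht f.
    - simpl. rewrite Rmult_1_r. apply Hd. simpl in Ht. lra.
    - destruct (Rle_dec t d) as [Htd|Htd].
      + eapply Rle_trans; [apply Hd; lra|].
        apply Rmult_le_compat_r; [apply norm_ge_0|].
        rewrite <- (pow_1 M) at 1. apply Rle_pow; [exact HM|lia].
      + replace t with (d + (t - d)) by ring. rewrite S_plus by lra.
        eapply Rle_trans; [apply Hd; lra|].
        cbn [Nat.add pow]. rewrite Rmult_assoc. apply Rmult_le_compat_l; [lra|].
        apply IH. rewrite S_INR in Ht. lra. }
  destruct (Rle_dec 0 b) as [Hb|Hb].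
  - destruct (nfloor_ex (b / d)) as [n Hn].
    { apply Rdiv_le_0_compat; lra. }
    exists (M ^ (n + 1)). split; [apply pow_R1_Rle, HM|].
    intros t Ht. apply Hpow. split; [easy|].
    apply Rle_trans with (b / d * d); [replace (b / d * d) with b by (field; lra); easy|].
    apply Rmult_le_compat_r; lra.
  - exists 1. split; [lra|]. intros t Ht. lra.
Qed.

(** For [a <= b] one has [S b f - S a f = S a (S (b - a) f - f)], which is small
    uniformly in [a] on bounded intervals; left continuity thus rests on
    [semigroup_bounded].  The orbit is reflected to negative times so that it is
    continuous on the whole line and two-sided calculus applies to it. *)
Lemma orbit_continuous f t : continuous (fun s => S (Rabs s) f) t.
Proof.
  apply (filterlim_locally_ball_norm (F := locally t) (fun s => S (Rabs s) f)).
  intros eps. assert (Heps := cond_pos eps).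
  destruct (semigroup_bounded (Rabs t + 1)) as [M [HM HS]].
  assert (He : 0 < eps / M) by (apply Rdiv_lt_0_compat; lra).
  destruct (proj1 (filterlim_locally_ball_norm (F := at_right 0) (fun s => S s f) f)
    (S_continuous f) (mkposreal _ He)) as [d Hd].
  assert (Hinc : forall a b, 0 <= a <= b -> b <= Rabs t + 1 -> b - a < d ->
    norm (minus (S b f) (S a f)) < eps).
  { intros a b Ha Hb Hab. destruct (Req_dec a b) as [<-|Hne].
    - eapply Rle_lt_trans; [exact (Req_le _ _ (norm_minus_self (V := V) (S a f)))|exact Heps].
    - replace b with (a + (b - a)) by ring. rewrite semigroup_increment by lra.
      eapply Rle_lt_trans; [apply (HS a); lra|].
      replace (pos eps) with (M * (eps / M)) by (field; lra).
      apply Rmult_lt_compat_l; [lra|]. apply (Hd (b - a)); [|lra].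
      change (Rabs (b - a - 0) < d). rewrite Rminus_0_r, Rabs_pos_eq; lra. }
  assert (Hr : 0 < Rmin d 1) by (apply Rmin_pos; [apply cond_pos|lra]).
  exists (mkposreal _ Hr). intros s Hs. change (Rabs (s - t) < Rmin d 1) in Hs.
  assert (H1 := Rmin_l d 1). assert (H2 := Rmin_r d 1).
  assert (H3 := Rabs_triang_inv2 s t). assert (Hs0 := Rabs_pos s). assert (Ht0 := Rabs_pos t).
  unfold ball_norm. destruct (Rle_dec (Rabs t) (Rabs s)) as [H|H].
  - rewrite Rabs_pos_eq in H3 by lra. apply Hinc; lra.
  - rewrite Rabs_minus_sym, Rabs_pos_eq in H3 by lra.
    eapply Rle_lt_trans; [apply Req_le, norm_minus_sym|]. apply Hinc; lra.
Qed.

Definition orbit_integral (f : V) (t : R) : V := RInt (fun s => S (Rabs s) f) 0 t.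

Lemma orbit_integral_zero f : orbit_integral f 0 = zero.
Proof. apply RInt_point. Qed.

Lemma is_derive_orbit_integral f t : is_derive (orbit_integral f) t (S (Rabs t) f).
Proof.
  apply (is_derive_RInt (fun s => S (Rabs s) f) (orbit_integral f) 0 t).
  - apply filter_forall. intros s. apply (RInt_correct (V := V)).
    apply (ex_RInt_continuous (V := V)). intros r _. apply orbit_continuous.
  - apply orbit_continuous.
Qed.

Lemma continuous_orbit_integral f t : continuous (orbit_integral f) t.
Proof. apply (ex_derive_continuous (V := V)). eexists. apply is_derive_orbit_integral. Qed.

Definition has_generator_value (f g : V) : Prop :=
  filterlim (fun t => scal (/ t) (minus (S t f) f)) (at_right 0) (locally g).

Lemma has_generator_value_orbit f g t : 0 <= t ->
  has_generator_value f g -> has_generator_value (S t f) (S t g).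
Proof.
  intros Ht Hg. unfold has_generator_value.
  apply filterlim_within_ext with (fun h => S t (scal (/ h) (minus (S h f) f))).
  - intros h Hh. rewrite (linear_scal (S t) (S_linear t Ht)), <- semigroup_increment by lra.
    rewrite (Rplus_comm t h), S_plus by lra. reflexivity.
  - apply filterlim_comp with (1 := Hg). apply (linear_cont (S t) g), S_linear, Ht.
Qed.

(** The difference of the two sides is a curve whose right derivative vanishes
    everywhere: only the quotients on the right are governed directly by the
    generator, which is why the increment bound is used rather than a derivative.
    The integral formula then gives two-sided derivatives of orbits. *)
Lemma has_generator_value_iff f g :
  has_generator_value f g <->
  forall t, 0 <= t -> minus (S t f) f = orbit_integral g t.
Proof.
  split.
  - intros Hg t Ht.
    pose (v := fun s => minus (S (Rabs s) f) (orbit_integral g s)).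
    assert (Hv : forall e, 0 < e -> norm (minus (v t) (v 0)) <= e * (t - 0)).
    { intros e He. apply (norm_increment_le (V := V)); [lra|lra| |].
      - intros s _. apply (continuous_minus (V := V)).
        + apply orbit_continuous.
        + apply continuous_orbit_integral.
      - intros s Hs _.
        destruct (proj1 (right_quotient_limit_iff (V := V) _ _)
          (has_generator_value_orbit f g s ltac:(lra) Hg) (e / 2) ltac:(lra)) as [d1 H1].
        destruct (is_derive_near (V := V) _ _ _ (is_derive_orbit_integral g s) (e / 2) ltac:(lra))
          as [d2 H2].
        assert (Hd : 0 < Rmin d1 d2) by (apply Rmin_pos; apply cond_pos).
        assert (Hd1 := Rmin_l d1 d2). assert (Hd2 := Rmin_r d1 d2).
        exists (mkposreal _ Hd). intros r Hr. simpl in Hr.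
        specialize (H1 (r - s) ltac:(lra)).
        specialize (H2 r ltac:(rewrite Rabs_pos_eq; lra)).
        rewrite !Rabs_pos_eq in H2 by lra. rewrite <- S_plus in H1 by lra.
        replace (r - s + s) with r in H1 by ring.
        unfold v. rewrite !Rabs_pos_eq by lra.
        eapply Rle_trans; [exact (Req_le _ _ (f_equal norm (minus_minus_swap (V := V)
          (S r f) (orbit_integral g r) (S s f) (orbit_integral g s))))|].
        eapply Rle_trans; [apply (norm_minus_triangle (V := V)) with (y := scal (r - s) (S s g))|].
        replace (e * (r - s)) with (e / 2 * (r - s) + e / 2 * (r - s)) by field.
        apply Rplus_le_compat; [exact H1|].
        eapply Rle_trans; [|exact H2]. apply Req_le, (norm_minus_sym (V := V)). }
    assert (H : v t = v 0).
    { apply (eq_of_minus_zero (V := V)), (norm_eq_zero (V := V)), Rle_antisym;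
        [|apply (norm_ge_0 (V := V))].
      apply le_epsilon. intros e He.
      eapply Rle_trans; [apply (Hv (e / (t + 1)))|].
      - apply Rdiv_lt_0_compat; lra.
      - rewrite Rplus_0_l, Rminus_0_r.
        replace e with (e / (t + 1) * (t + 1)) at 2 by (field; lra).
        apply Rmult_le_compat_l; [|lra]. apply Rlt_le, Rdiv_lt_0_compat; lra. }
    unfold v in H. rewrite Rabs_R0, S_zero, orbit_integral_zero, Rabs_pos_eq in H by easy.
    apply (minus_eq_of_minus_eq_minus_zero (V := V)), H.
  - intros H. unfold has_generator_value.
    apply filterlim_within_ext with
      (fun r => scal (/ r) (minus (orbit_integral g (0 + r)) (orbit_integral g 0))).
    + intros r Hr. rewrite Rplus_0_l, orbit_integral_zero, H by lra. f_equal.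
      apply (minus_zero_r (G := V)).
    + apply (is_derive_right_quotient (V := V)).
      assert (H' := is_derive_orbit_integral g 0). rewrite Rabs_R0, S_zero in H'. exact H'.
Qed.

Lemma is_derive_orbit f g t : 0 < t -> has_generator_value f g ->
  is_derive (fun s => S (Rabs s) f) t (S t g).
Proof.
  intros Ht Hg.
  apply (is_derive_ext_loc (fun s => plus f (orbit_integral g s))).
  - exists (mkposreal t Ht). intros s Hs. change (Rabs (s - t) < t) in Hs.
    apply Rabs_def2 in Hs. rewrite (Rabs_pos_eq s) by lra.
    rewrite <- (proj1 (has_generator_value_iff f g) Hg) by lra.
    etransitivity; [apply (plus_comm (G := V))|apply (plus_minus_l (V := V))].
  - assert (H := is_derive_plus (fun _ : R => f) (orbit_integral g) t zero (S (Rabs t) g)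
      (is_derive_const f t) (is_derive_orbit_integral g t)).
    rewrite plus_zero_l, Rabs_pos_eq in H by lra. exact H.
Qed.

(** Both sides vanish at [t = 0] and have the derivative [S (s + t) f], which
    avoids exchanging [S s] with the integral. *)
Lemma semigroup_orbit_integral f s t : 0 <= s -> 0 <= t ->
  S s (orbit_integral f t) = minus (orbit_integral f (s + t)) (orbit_integral f s).
Proof.
  intros Hs Ht.
  pose (v := fun r => minus (S s (orbit_integral f r)) (orbit_integral f (s + r))).
  assert (Hd : forall r, is_derive v r (minus (S s (S (Rabs r) f)) (S (Rabs (s + r)) f))).
  { intros r. apply (is_derive_minus (V := V)).
    - apply is_derive_linear; [apply S_linear, Hs|apply is_derive_orbit_integral].
    - assert (Hshift : is_derive (fun r => s + r) r 1) by (auto_derive; [exact I|ring]).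
      assert (H := is_derive_comp (orbit_integral f) (fun r => s + r) r _ 1
        (is_derive_orbit_integral f (s + r)) Hshift).
      change (is_derive (fun r => orbit_integral f (s + r)) r
        (scal one (S (Rabs (s + r)) f))) in H.
      rewrite scal_one in H. exact H. }
  assert (H : v t = v 0).
  { apply (constant_of_is_derive_zero (V := V)); [exact Ht| |].
    - intros r _. apply (ex_derive_continuous (V := V)). eexists. apply Hd.
    - intros r Hr. assert (Hr0 := Hd r). rewrite !Rabs_pos_eq, S_plus in Hr0 by lra.
      rewrite (minus_eq_zero (G := V) (S s (S r f))) in Hr0. exact Hr0. }
  unfold v in H. rewrite orbit_integral_zero, Rplus_0_r in H.
  replace (S s zero) with (zero : V) in H by (symmetry; apply (linear_zero (S s)), S_linear, Hs).
  apply (eq_minus_of_minus_eq_zero_minus (V := V)). exact H.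
Qed.

(** By [semigroup_orbit_integral] the difference quotient of the semigroup at the
    integral is the right difference quotient at [0] of
    [r |-> orbit_integral f (r + t) - orbit_integral f r]. *)
Lemma orbit_integral_in_domain f t : 0 <= t ->
  has_generator_value (orbit_integral f t) (minus (S t f) f).
Proof.
  intros Ht. unfold has_generator_value.
  apply filterlim_within_ext with
    (fun r => scal (/ r) (minus (minus (orbit_integral f ((0 + r) + t)) (orbit_integral f (0 + r)))
                                (minus (orbit_integral f (0 + t)) (orbit_integral f 0)))).
  - intros r Hr. rewrite semigroup_orbit_integral, !Rplus_0_l, orbit_integral_zero by lra.
    do 2 f_equal. apply (minus_zero_r (G := V)).
  - apply (is_derive_right_quotient (V := V)
      (fun r => minus (orbit_integral f (r + t)) (orbit_integral f r))).
    apply (is_derive_minus (V := V)).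
    + assert (Hshift : is_derive (fun r => r + t) 0 1) by (auto_derive; [exact I|ring]).
      assert (H := is_derive_comp (orbit_integral f) (fun r => r + t) 0 _ 1
        (is_derive_orbit_integral f (0 + t)) Hshift).
      change (is_derive (fun r => orbit_integral f (r + t)) 0
        (scal one (S (Rabs (0 + t)) f))) in H.
      rewrite scal_one, Rplus_0_l, Rabs_pos_eq in H by easy. exact H.
    + assert (H := is_derive_orbit_integral f 0). rewrite Rabs_R0, S_zero in H. exact H.
Qed.

(** Density of the domain: [f] is the derivative at [0] of the curve
    [t |-> orbit_integral f t], which runs in the domain. *)
Lemma linear_eq_of_eq_on_domain {W : NormedModule R_AbsRing} (L1 L2 : V -> W) :
  is_linear L1 -> is_linear L2 ->
  (forall f g, has_generator_value f g -> L1 f = L2 f) ->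
  forall f, L1 f = L2 f.
Proof.
  intros HL1 HL2 Heq f.
  assert (Hd : forall L : V -> W, is_linear L ->
    is_derive (fun t => L (orbit_integral f t)) 0 (L f)).
  { intros L HL. apply is_derive_linear; [exact HL|].
    assert (H := is_derive_orbit_integral f 0). rewrite Rabs_R0, S_zero in H. exact H. }
  apply (is_derive_at_unique_of_eq_right (fun t => L1 (orbit_integral f t))
    (fun t => L2 (orbit_integral f t)) 0).
  - intros t Ht. eapply Heq. apply orbit_integral_in_domain, Ht.
  - apply Hd, HL1.
  - apply Hd, HL2.
Qed.

End Semigroup.

(** * Restriction of scalars *)

Section RestrictScalars.

Context (X : CompleteNormedModule C_AbsRing).

Definition real_scal (r : R) (x : X) : X := scal (RtoC r : C_AbsRing) x.

Lemma real_ModuleSpace_mixin : ModuleSpace.mixin_of R_Ring X.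
Proof.
  exists real_scal; unfold real_scal.
  - intros r s x. rewrite scal_assoc. f_equal. symmetry. exact (RtoC_mult r s).
  - intros x. exact (scal_one x).
  - intros r x y. exact (scal_distr_l (RtoC r : C_AbsRing) x y).
  - intros r s x. etransitivity; [|exact (scal_distr_r (RtoC r : C_AbsRing) (RtoC s) x)].
    f_equal. exact (RtoC_plus r s).
Defined.

(** Everything but the scalar action is taken over from [X] unchanged, so limits
    and norms in [X] and in the real space agree by conversion. *)
Definition real_ModuleSpace : ModuleSpace R_Ring :=
  ModuleSpace.Pack R_Ring X
    (ModuleSpace.Class R_Ring X (AbelianGroup.class X) real_ModuleSpace_mixin) X.

Definition real_NormedModuleAux : NormedModuleAux R_AbsRing :=
  NormedModuleAux.Pack R_AbsRing X
    (NormedModuleAux.Class R_AbsRing X (ModuleSpace.class _ real_ModuleSpace)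
      (UniformSpace.class X)) X.

Lemma real_NormedModule_mixin : NormedModule.mixin_of R_AbsRing real_NormedModuleAux.
Proof.
  apply (NormedModule.Mixin R_AbsRing real_NormedModuleAux (@norm C_AbsRing X) (@norm_factor C_AbsRing X)).
  - exact (@norm_triangle C_AbsRing X).
  - intros r x. eapply Rle_trans; [exact (@norm_scal C_AbsRing X (RtoC r) x)|].
    apply Req_le. f_equal. exact (Cmod_R r).
  - exact (@norm_compat1 C_AbsRing X).
  - exact (@norm_compat2 C_AbsRing X).
  - exact (@norm_eq_zero C_AbsRing X).
Defined.

Definition real_NormedModule : NormedModule R_AbsRing :=
  NormedModule.Pack R_AbsRing X
    (NormedModule.Class R_AbsRing X (NormedModuleAux.class _ real_NormedModuleAux)
      real_NormedModule_mixin) X.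

Definition real_CompleteNormedModule : CompleteNormedModule R_AbsRing :=
  CompleteNormedModule.Pack R_AbsRing X
    (CompleteNormedModule.Class R_AbsRing X (NormedModule.class _ real_NormedModule)
      (CompleteNormedModule.mixin _ X (CompleteNormedModule.class _ X))) X.

End RestrictScalars.

Lemma real_is_linear_endomorphism {X : CompleteNormedModule C_AbsRing} (L : X -> X) :
  @is_linear C_AbsRing X X L ->
  @is_linear R_AbsRing (real_CompleteNormedModule X) (real_CompleteNormedModule X) L.
Proof.
  intros [Hplus Hscal Hnorm]. split; [exact Hplus| |exact Hnorm].
  intros r x. exact (Hscal (RtoC r) x).
Qed.

Lemma real_is_linear_functional {X : CompleteNormedModule C_AbsRing} (L : X -> C) :
  @is_linear C_AbsRing X C_NormedModule L ->
  @is_linear R_AbsRing (real_CompleteNormedModule X) C_R_NormedModule L.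
Proof.
  intros [Hplus Hscal [M [HM Hnorm]]]. split; [exact Hplus| |].
  - intros r x. etransitivity; [exact (Hscal (RtoC r) x)|]. symmetry. exact (scal_R_Cmult r (L x)).
  - exists M. split; [exact HM|]. intros x. etransitivity; [|exact (Hnorm x)].
    apply Req_le, eq_sym, Cmod_norm.
Qed.

(** * Evaluation along curves *)

Lemma filterlim_C_iff {T : Type} {F : (T -> Prop) -> Prop} {FF : Filter F} (f : T -> C) (l : C) :
  filterlim f F (locally l) <-> forall eps : posreal, F (fun x => Cmod (f x - l)%C < eps).
Proof. exact (filterlim_locally_ball_norm (U := C_NormedModule) f l). Qed.

Lemma is_derive_C_iff (u : R -> C) (s : R) (l : C) :
  is_derive (V := C_R_NormedModule) u s l <->
  forall eps, 0 < eps -> exists delta : posreal, forall r, Rabs (r - s) < delta ->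
    Cmod (u r - u s - RtoC (r - s) * l)%C <= eps * Rabs (r - s).
Proof.
  assert (E : forall r, @norm R_AbsRing C_R_NormedModule
    (minus (minus (u r) (u s)) (scal (r - s) l)) = Cmod (u r - u s - RtoC (r - s) * l)%C).
  { intros r. etransitivity; [symmetry; apply Cmod_norm|].
    exact (f_equal (fun w => Cmod (u r - u s - w)%C) (scal_R_Cmult (r - s) l)). }
  split.
  - intros H eps Heps. destruct (is_derive_near (V := C_R_NormedModule) u s l H eps Heps) as [d Hd].
    exists d. intros r Hr. rewrite <- E. apply Hd, Hr.
  - intros H. split; [apply is_linear_scal_l|].
    intros x Hx. apply (@is_filter_lim_locally_unique _ R_NormedModule) in Hx. subst x.
    intros [eps Heps]. destruct (H eps Heps) as [d Hd]. exists d. intros r Hr.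
    specialize (Hd r Hr). rewrite <- E in Hd. exact Hd.
Qed.

Lemma is_C_derive_near (f : C -> C) (w l : C) :
  @is_derive C_AbsRing C_NormedModule f w l ->
  forall eps, 0 < eps -> exists delta : posreal, forall y, Cmod (y - w)%C < delta ->
    Cmod (f y - f w - (y - w) * l)%C <= eps * Cmod (y - w)%C.
Proof.
  intros [_ H] eps Heps. destruct (H w (fun P HP => HP) (mkposreal eps Heps)) as [d Hd].
  exists d. exact Hd.
Qed.

Lemma ex_C_derive_continuous (f : C -> C) (w : C) :
  @ex_derive C_AbsRing C_NormedModule f w -> filterlim f (locally w) (locally (f w)).
Proof.
  intros H P HP. apply locally_C. exact (ex_derive_continuous f w H P HP).
Qed.

Lemma is_derive_comp_C (f : C -> C) (u : R -> C) (s : R) (l m : C) :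
  is_derive (V := C_R_NormedModule) u s l ->
  @is_derive C_AbsRing C_NormedModule f (u s) m ->
  is_derive (V := C_R_NormedModule) (fun r => f (u r)) s (l * m)%C.
Proof.
  intros Hu Hf. apply is_derive_C_iff. intros eps Heps.
  rewrite is_derive_C_iff in Hu.
  assert (Hl := Cmod_ge_0 l). assert (Hm := Cmod_ge_0 m).
  set (e1 := eps / (2 * (Cmod l + 1))).
  assert (He1 : 0 < e1) by (apply Rdiv_lt_0_compat; lra).
  set (e2 := eps / (2 * (Cmod m + 1))).
  assert (He2 : 0 < e2) by (apply Rdiv_lt_0_compat; lra).
  destruct (is_C_derive_near f (u s) m Hf e1 He1) as [d1 H1].
  destruct (Hu e2 He2) as [d2 H2]. destruct (Hu 1 Rlt_0_1) as [d3 H3].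
  assert (Hlip : forall r, Rabs (r - s) < d3 -> Cmod (u r - u s)%C <= (Cmod l + 1) * Rabs (r - s)).
  { intros r Hr. specialize (H3 r Hr).
    replace (u r - u s)%C with ((u r - u s - RtoC (r - s) * l) + RtoC (r - s) * l)%C by ring.
    eapply Rle_trans; [apply Cmod_triangle|]. rewrite Cmod_mult, Cmod_R. lra. }
  set (d := Rmin (d1 / (Cmod l + 1)) (Rmin d2 d3)).
  assert (Hd1 := cond_pos d1). assert (Hd2 := cond_pos d2). assert (Hd3 := cond_pos d3).
  assert (Hd : 0 < d).
  { apply Rmin_pos; [apply Rdiv_lt_0_compat; lra|apply Rmin_pos; lra]. }
  exists (mkposreal d Hd). intros r Hr. simpl in Hr.
  assert (Hr1 : Rabs (r - s) < d1 / (Cmod l + 1)) by (eapply Rlt_le_trans; [exact Hr|apply Rmin_l]).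
  assert (Hr2 : Rabs (r - s) < d2).
  { eapply Rlt_le_trans; [exact Hr|eapply Rle_trans; [apply Rmin_r|apply Rmin_l]]. }
  assert (Hr3 : Rabs (r - s) < d3).
  { eapply Rlt_le_trans; [exact Hr|eapply Rle_trans; [apply Rmin_r|apply Rmin_r]]. }
  specialize (Hlip r Hr3). specialize (H2 r Hr2).
  assert (Hr1' : (Cmod l + 1) * Rabs (r - s) < d1).
  { apply Rmult_lt_compat_l with (r := Cmod l + 1) in Hr1; [|lra].
    replace ((Cmod l + 1) * (d1 / (Cmod l + 1))) with (pos d1) in Hr1 by (field; lra). exact Hr1. }
  specialize (H1 (u r) ltac:(lra)).
  replace (f (u r) - f (u s) - RtoC (r - s) * (l * m))%C with
    ((f (u r) - f (u s) - (u r - u s) * m) + (u r - u s - RtoC (r - s) * l) * m)%C by ring.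
  eapply Rle_trans; [apply Cmod_triangle|]. rewrite Cmod_mult.
  assert (Hr0 := Rabs_pos (r - s)).
  assert (Ha : e1 * Cmod (u r - u s)%C <= eps / 2 * Rabs (r - s)).
  { replace (eps / 2) with (e1 * (Cmod l + 1)) by (unfold e1; field; lra).
    rewrite Rmult_assoc. apply Rmult_le_compat_l; lra. }
  assert (Hb : Cmod (u r - u s - RtoC (r - s) * l)%C * Cmod m <= eps / 2 * Rabs (r - s)).
  { apply Rle_trans with (e2 * Rabs (r - s) * (Cmod m + 1)).
    - apply Rmult_le_compat; try lra. apply Cmod_ge_0.
    - apply Req_le. unfold e2. field. lra. }
  lra.
Qed.

Section Evaluation.

Context (Omega : C -> Prop) (Omega_open : open Omega)
  (X : CompleteNormedModule C_AbsRing) (ev : X -> C -> C)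
  (HX : banach_of_holomorphic Omega X ev).

Let XR := real_CompleteNormedModule X.

Lemma evaluation_linear w : Omega w ->
  @is_linear R_AbsRing XR C_R_NormedModule (fun f => ev f w).
Proof. intros Hw. apply real_is_linear_functional, (ev_bounded_linear _ _ _ HX), Hw. Qed.

Lemma evaluation_minus w (f g : XR) : Omega w -> ev (minus f g) w = (ev f w - ev g w)%C.
Proof. intros Hw. exact (linear_minus _ f g (evaluation_linear w Hw)). Qed.

Lemma evaluation_scal w (r : R) (f : XR) : Omega w -> ev (scal r f) w = (RtoC r * ev f w)%C.
Proof.
  intros Hw. etransitivity; [exact (linear_scal _ (evaluation_linear w Hw) r f)|].
  apply scal_R_Cmult.
Qed.

Lemma evaluation_continuous f w : Omega w -> filterlim (ev f) (locally w) (locally (ev f w)).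
Proof. intros Hw. apply ex_C_derive_continuous, (ev_holomorphic _ _ _ HX), Hw. Qed.

(** Uniform boundedness applies to the evaluations because each [ev f] is
    continuous at [w]. *)
Lemma evaluation_locally_bounded w : Omega w -> exists M, 0 <= M /\
  locally w (fun y => Omega y /\ forall f : XR, Cmod (ev f y) <= M * norm f).
Proof.
  intros Hw.
  destruct (banach_steinhaus_near (V := XR) (W := C_R_NormedModule) (fun y f => ev f y) w Omega)
    as [M [HM HMw]].
  - intros y Hy. apply evaluation_linear, Hy.
  - intros f. exists (ev f w). intros P HP. apply filter_le_within.
    exact (evaluation_continuous f w Hw P HP).
  - exists M. split; [exact HM|].
    assert (HO := Omega_open w Hw).
    apply (filter_imp (fun y => Omega y /\ (Omega y -> forall f : XR, @norm R_AbsRing C_R_NormedModule (ev f y) <= M * norm f))).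
    + intros y [Hy H]. split; [exact Hy|]. intros f. eapply Rle_trans; [|apply H, Hy].
      apply Req_le, Cmod_norm.
    + apply filter_and; [exact HO|exact HMw].
Qed.

Lemma evaluation_jointly_continuous (x : R -> XR) (u : R -> C) s :
  Omega (u s) -> continuous x s -> continuous u s -> continuous (fun r => ev (x r) (u r)) s.
Proof.
  intros Hus Hx Hu. apply filterlim_C_iff. intros eps.
  destruct (evaluation_locally_bounded (u s) Hus) as [M [HM HMw]].
  assert (He : 0 < eps / (2 * (M + 1))).
  { apply Rdiv_lt_0_compat; [apply cond_pos|lra]. }
  assert (H1 := proj1 (filterlim_locally_ball_norm x (x s)) Hx (mkposreal _ He)).
  assert (H2 : locally s (fun r => Omega (u r) /\ forall f : XR, Cmod (ev f (u r)) <= M * norm f))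
    by exact (Hu _ HMw).
  assert (H3 : locally s (fun r => Cmod (ev (x s) (u r) - ev (x s) (u s))%C < pos_div_2 eps))
    by exact (proj1 (filterlim_C_iff _ _) (filterlim_comp _ _ _ _ _ _ _ _ Hu (evaluation_continuous (x s) (u s) Hus))
      (pos_div_2 eps)).
  generalize (filter_and _ _ H1 (filter_and _ _ H2 H3)). apply filter_imp.
  intros r [Hr1 [[Hr2 HrM] Hr3]]. simpl in Hr3.
  replace (ev (x r) (u r) - ev (x s) (u s))%C with
    (ev (minus (x r) (x s)) (u r) + (ev (x s) (u r) - ev (x s) (u s)))%C
    by (rewrite evaluation_minus by exact Hr2; ring).
  eapply Rle_lt_trans; [apply Cmod_triangle|].
  specialize (HrM (minus (x r) (x s))). unfold ball_norm in Hr1. simpl in Hr1.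
  assert (Hb : M * norm (minus (x r) (x s)) <= eps / 2).
  { apply Rle_trans with ((M + 1) * (eps / (2 * (M + 1)))).
    - apply Rmult_le_compat; try lra. apply (norm_ge_0 (V := XR)). left. exact Hr1.
    - apply Req_le. field. lra. }
  assert (Hp := cond_pos eps). apply (Rle_lt_trans _ (eps / 2 + Cmod (ev (x s) (u r) - ev (x s) (u s))%C)); [|lra].
  apply Rplus_le_compat_r. eapply Rle_trans; [exact HrM|exact Hb].
Qed.

(** The increment splits into the remainder of [x] evaluated at the moving point,
    controlled by [evaluation_locally_bounded], the variation of [ev x'] along
    [u], and the increment of the fixed function [ev (x s)] along [u]. *)
Lemma evaluation_product_rule (x : R -> XR) (u : R -> C) s (x' : XR) (u' : C) :
  Omega (u s) -> is_derive x s x' -> is_derive (V := C_R_NormedModule) u s u' ->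
  is_derive (V := C_R_NormedModule) (fun r => ev (x r) (u r)) s
    (ev x' (u s) + u' * C_derive (ev (x s)) (u s))%C.
Proof.
  intros Hus Hx Hu. apply is_derive_C_iff. intros eps Heps.
  destruct (evaluation_locally_bounded (u s) Hus) as [M [HM HMw]].
  assert (Huc : continuous u s).
  { apply (ex_derive_continuous (V := C_R_NormedModule)). exists u'. exact Hu. }
  assert (He1 : 0 < eps / (3 * (M + 1))) by (apply Rdiv_lt_0_compat; lra).
  destruct (is_derive_near x s x' Hx _ He1) as [d1 H1].
  destruct (Huc _ HMw) as [d2 H2].
  assert (Hf : is_derive (V := C_R_NormedModule) (fun r => ev (x s) (u r)) s
    (u' * C_derive (ev (x s)) (u s))%C).
  { apply is_derive_comp_C; [exact Hu|]. apply C_derive_correct; [exact 0%C|].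
    apply (ev_holomorphic _ _ _ HX), Hus. }
  destruct (proj1 (is_derive_C_iff _ _ _) Hf (eps / 3) ltac:(lra)) as [d3 H3].
  destruct (proj1 (filterlim_C_iff _ _)
    (filterlim_comp _ _ _ _ _ _ _ _ Huc (evaluation_continuous x' (u s) Hus))
    (mkposreal (eps / 3) ltac:(lra))) as [d4 H4].
  assert (Hd : 0 < Rmin (Rmin d1 d2) (Rmin d3 d4)).
  { repeat apply Rmin_pos; apply cond_pos. }
  exists (mkposreal _ Hd). intros r Hr. simpl in Hr.
  assert (Hr12 : Rabs (r - s) < Rmin d1 d2) by (eapply Rlt_le_trans; [exact Hr|apply Rmin_l]).
  assert (Hr34 : Rabs (r - s) < Rmin d3 d4) by (eapply Rlt_le_trans; [exact Hr|apply Rmin_r]).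
  specialize (H1 r ltac:(eapply Rlt_le_trans; [exact Hr12|apply Rmin_l])).
  destruct (H2 r ltac:(eapply Rlt_le_trans; [exact Hr12|apply Rmin_r])) as [Hur HMr].
  specialize (H3 r ltac:(eapply Rlt_le_trans; [exact Hr34|apply Rmin_l])).
  specialize (H4 r ltac:(eapply Rlt_le_trans; [exact Hr34|apply Rmin_r])).
  clear Hr12 Hr34. cbv beta in H3, H4. simpl in H4.
  set (y := minus (minus (x r) (x s)) (scal (r - s) x')) in *.
  assert (Hy : ev y (u r) = (ev (x r) (u r) - ev (x s) (u r) - RtoC (r - s) * ev x' (u r))%C).
  { unfold y. rewrite !evaluation_minus, evaluation_scal by exact Hur. reflexivity. }
  replace (ev (x r) (u r) - ev (x s) (u s) -
      RtoC (r - s) * (ev x' (u s) + u' * C_derive (ev (x s)) (u s)))%C with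
    (ev y (u r) + (RtoC (r - s) * (ev x' (u r) - ev x' (u s)) +
     (ev (x s) (u r) - ev (x s) (u s) - RtoC (r - s) * (u' * C_derive (ev (x s)) (u s)))))%C
    by (rewrite Hy; ring).
  eapply Rle_trans; [apply Cmod_triangle|].
  eapply Rle_trans; [apply Rplus_le_compat_l, Cmod_triangle|].
  rewrite Cmod_mult, Cmod_R.
  assert (Hr0 := Rabs_pos (r - s)).
  assert (Ha : Cmod (ev y (u r)) <= eps / 3 * Rabs (r - s)).
  { eapply Rle_trans; [apply HMr|].
    apply Rle_trans with ((M + 1) * (eps / (3 * (M + 1)) * Rabs (r - s))).
    - apply Rmult_le_compat; try lra. apply (norm_ge_0 (V := XR)). exact H1.
    - apply Req_le. field. lra. }
  assert (Hb : Rabs (r - s) * Cmod (ev x' (u r) - ev x' (u s))%C <= Rabs (r - s) * (eps / 3)).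
  { apply Rmult_le_compat_l; lra. }
  lra.
Qed.

End Evaluation.

(** * Cluster points on the sphere *)

Lemma filterlim_of_ge_id (k : nat -> nat) :
  (forall n, (n <= k n)%nat) -> filterlim k eventually eventually.
Proof.
  intros Hk P [N HN]. exists N. intros n Hn. apply HN. specialize (Hk n). lia.
Qed.

Lemma choose_ge (P : nat -> nat -> Prop) :
  (forall n, exists p, (n <= p)%nat /\ P n p) ->
  exists k : nat -> nat, (forall n, (n <= k n)%nat) /\ forall n, P n (k n).
Proof.
  intros H.
  exists (fun n => proj1_sig (constructive_indefinite_description _ (H n))).
  split; intros n; destruct (constructive_indefinite_description _ (H n)) as [p [H1 H2]]; assumption.
Qed.

Lemma bounded_real_subsequence (x : nat -> R) (M : R) :
  (forall n, Rabs (x n) <= M) ->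
  exists k : nat -> nat, (forall n, (n <= k n)%nat) /\
    exists l : R, filterlim (fun n => x (k n)) eventually (locally l).
Proof.
  intros HM.
  destruct (Bolzano_Weierstrass x (fun r => - M <= r <= M) (compact_P3 (- M) M)) as [l Hl].
  { intros n. apply Rabs_le_between, HM. }
  destruct (choose_ge (fun n p => Rabs (x p - l) < / (INR n + 1))) as [k [Hk Hkl]].
  { intros n. destruct (Hl (disc l (mkposreal _ (RinvN_pos n))) n) as [p [Hp1 Hp2]].
    - exists (mkposreal _ (RinvN_pos n)). intros y Hy. exact Hy.
    - exists p. split; assumption. }
  exists k. split; [exact Hk|]. exists l. apply filterlim_locally. intros eps.
  destruct (nfloor_ex (/ eps)) as [N HN].
  { apply Rlt_le, Rinv_0_lt_compat, cond_pos. }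
  exists N. intros n Hn. change (Rabs (x (k n) - l) < eps).
  eapply Rlt_trans; [apply Hkl|]. rewrite <- (Rinv_inv eps).
  assert (Hp := Rinv_0_lt_compat _ (cond_pos eps)).
  assert (HnN := le_INR _ _ Hn).
  apply Rinv_lt_contravar; [apply Rmult_lt_0_compat; lra|lra].
Qed.

(** Sequential compactness of the sphere: if the moduli do not tend to infinity,
    a subsequence is bounded and Bolzano-Weierstrass applies to each coordinate. *)
Lemma sphere_subsequence (zn : nat -> C) :
  exists k : nat -> nat, (forall n, (n <= k n)%nat) /\
    exists z, sphere_lim (fun n => zn (k n)) z.
Proof.
  destruct (excluded_middle_informative
    (exists M, forall N, exists n, (N <= n)%nat /\ Cmod (zn n) <= M)) as [[M HM]|Hn].
  - destruct (choose_ge (fun _ p => Cmod (zn p) <= M) HM) as [k0 [Hk0 HM0]].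
    destruct (bounded_real_subsequence (fun n => fst (zn (k0 n))) M) as [k1 [Hk1 [l1 Hl1]]].
    { intros n. eapply Rle_trans; [|apply (HM0 n)].
      eapply Rle_trans; [apply Rmax_l|apply Rmax_Cmod]. }
    destruct (bounded_real_subsequence (fun n => snd (zn (k0 (k1 n)))) M) as [k2 [Hk2 [l2 Hl2]]].
    { intros n. eapply Rle_trans; [|apply (HM0 (k1 n))].
      eapply Rle_trans; [apply Rmax_r|apply Rmax_Cmod]. }
    exists (fun n => k0 (k1 (k2 n))). split.
    + intros n. specialize (Hk2 n). specialize (Hk1 (k2 n)). specialize (Hk0 (k1 (k2 n))). lia.
    + exists (Some (l1, l2)). simpl.
      assert (Hl1' := filterlim_comp _ _ _ _ _ _ _ _ (filterlim_of_ge_id k2 Hk2) Hl1).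
      apply (filterlim_locally (U := C_UniformSpace)). intros eps.
      generalize (filter_and _ _ (proj1 (filterlim_locally _ _) Hl1' eps)
        (proj1 (filterlim_locally _ _) Hl2 eps)).
      apply filter_imp. intros n [H1 H2]. split; assumption.
  - exists (fun n => n). split; [easy|]. exists None. simpl.
    apply is_lim_seq_spec. intros M. apply NNPP. intros H. apply Hn. exists M.
    intros N. apply NNPP. intros H'. apply H. exists N. intros n HnN.
    apply Rnot_le_lt. intros Hle. apply H'. exists n. split; assumption.
Qed.

Lemma sphere_lim_closure (Omega : C -> Prop) (zn : nat -> C) (z : option C) :
  (forall n, Omega (zn n)) -> sphere_lim zn z -> closure_or_infinity Omega z.
Proof.
  intros HO Hz. destruct z as [w|]; [|exact I]. intros eps.
  destruct (proj1 (filterlim_locally (U := C_UniformSpace) _ _) Hz eps) as [N HN].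
  exists (zn N). split; [apply HO|apply HN, le_n].
Qed.

(** * Continuing solutions of the differential equation *)

Lemma within_nonneg_proper (t : R) : 0 <= t ->
  ProperFilter (within (fun s : R => 0 <= s) (locally t)).
Proof.
  intros Ht. split; [|apply within_filter, locally_filter].
  intros P [d Hd]. exists t. apply Hd; [apply ball_center|exact Ht].
Qed.

Lemma within_nonneg_lim (t : R) : @is_filter_lim R_UniformSpace (within (fun s : R => 0 <= s) (locally t)) t.
Proof. intros P HP. apply filter_le_within. exact HP. Qed.

Lemma within_nonneg_lim_unique (t x : R) : 0 <= t ->
  @is_filter_lim R_UniformSpace (within (fun s : R => 0 <= s) (locally t)) x -> x = t.
Proof.
  intros Ht Hx. assert (H := within_nonneg_proper t Ht).
  apply (@is_filter_lim_unique _ R_NormedModule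
    (within (fun s : R => 0 <= s) (locally t)) _ x t Hx (within_nonneg_lim t)).
Qed.

Section Flow.

Context (Omega : C -> Prop) (G : C -> C) (G_holomorphic : holomorphic Omega G).

Lemma solution_is_derive z tau u t : solution Omega G z tau u ->
  0 < t -> Rbar_lt t tau -> is_derive (V := C_R_NormedModule) u t (G (u t)).
Proof.
  intros [_ [_ Hu]] Ht Htau. destruct (Hu t (Rlt_le _ _ Ht) Htau) as [_ [Hlin Hd]].
  split; [exact Hlin|]. intros x Hx.
  apply (@is_filter_lim_locally_unique _ R_NormedModule) in Hx. subst x. intros eps.
  assert (Hpos : locally t (fun s => 0 <= s)).
  { exists (mkposreal t Ht). intros s Hs. change (Rabs (s - t) < t) in Hs.
    apply Rabs_def2 in Hs. lra. }
  generalize (filter_and _ _ Hpos (Hd t (within_nonneg_lim t) eps)).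
  apply filter_imp. intros s [Hs H]. exact (H Hs).
Qed.

Lemma solution_continuous z tau u t : solution Omega G z tau u ->
  0 <= t -> Rbar_lt t tau -> continuous (fun s => u (Rabs s)) t.
Proof.
  intros [_ [_ Hu]] Ht Htau. destruct (Hu t Ht Htau) as [_ Hd].
  apply (filterlim_comp _ _ _ Rabs u (locally t) (within (fun s => 0 <= s) (locally t))).
  - intros P HP. rewrite <- (Rabs_pos_eq t Ht) in HP at 1.
    assert (H : locally t (fun s => 0 <= Rabs s -> P (Rabs s)))
      by exact (continuous_Rabs t (fun s => 0 <= s -> P s) HP).
    change (locally t (fun s => P (Rabs s))).
    revert H. apply filter_imp. intros s Hs. apply Hs, Rabs_pos.
  - rewrite (Rabs_pos_eq t Ht).
    apply (filterdiff_continuous_aux (U := R_NormedModule) (V := C_R_NormedModule)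
      (F := within (fun s => 0 <= s) (locally t)) u).
    + eexists. exact Hd.
    + apply within_nonneg_lim.
Qed.

(** Near [w] the speed is below [M].  Once the solution is close to [w] at a time
    [s0] close to [b], it is trapped near [w] on [[s0, b)]. *)
Lemma solution_tends_to_cluster_point z b u w : 0 < b ->
  solution Omega G z b u -> Omega w ->
  (forall e, 0 < e -> exists s, b - e < s < b /\ Cmod (u s - w)%C < e) ->
  forall e, 0 < e -> exists d, 0 < d /\ forall s, b - d < s < b -> Cmod (u s - w)%C < e.
Proof.
  intros Hb Hu Hw Hcl e He.
  assert (HG := ex_C_derive_continuous G w (G_holomorphic w Hw)).
  assert (HG1 := proj1 (filterlim_C_iff _ _) HG (mkposreal 1 Rlt_0_1)).
  apply locally_C in HG1. destruct HG1 as [rho Hrho].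
  set (M := Cmod (G w) + 1).
  assert (HM : 0 < M) by (assert (H := Cmod_ge_0 (G w)); unfold M; lra).
  assert (HGM : forall y, Cmod (y - w)%C < rho -> Cmod (G y) < M).
  { intros y Hy. specialize (Hrho y Hy). simpl in Hrho.
    replace (G y) with ((G y - G w) + G w)%C by ring.
    eapply Rle_lt_trans; [apply Cmod_triangle|]. unfold M. lra. }
  set (r := Rmin e rho).
  assert (Hr : 0 < r) by (apply Rmin_pos; [lra|apply cond_pos]).
  assert (Hre := Rmin_l e rho : r <= e). assert (Hrr := Rmin_r e rho : r <= rho).
  (* k + M k <= r leaves room for the distance at s0 plus the way travelled since *)
  set (k := Rmin b (r / (M + 1))).
  assert (Hk : 0 < k) by (apply Rmin_pos; [lra|apply Rdiv_lt_0_compat; lra]).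
  assert (Hkb := Rmin_l b (r / (M + 1)) : k <= b).
  assert (Hkr : (M + 1) * k <= r).
  { apply Rle_trans with ((M + 1) * (r / (M + 1))).
    - apply Rmult_le_compat_l; [lra|apply Rmin_r].
    - apply Req_le. field. lra. }
  destruct (Hcl k Hk) as [s0 [Hs0 Hus0]].
  exists (b - s0). split; [lra|]. intros s Hs.
  assert (Hnorm : forall y : C, @norm R_AbsRing C_R_NormedModule y = Cmod y).
  { intros y. symmetry. apply Cmod_norm. }
  assert (Hinc : Cmod (u s - u s0)%C <= M * (s - s0)).
  { rewrite <- Hnorm.
    apply (norm_increment_trapped (V := C_R_NormedModule) u w r M s0 s); try lra.
    - intros t Ht. apply (ex_derive_continuous (V := C_R_NormedModule)). exists (G (u t)).
      apply (solution_is_derive z b u t Hu); [lra|simpl; lra].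
    - intros t Ht Htr. exists (G (u t)). split.
      + apply (solution_is_derive z b u t Hu); [lra|simpl; lra].
      + rewrite Hnorm. apply HGM. eapply Rlt_le_trans; [|exact Hrr].
        eapply Rle_lt_trans; [|exact Htr]. apply Req_le. symmetry. apply Hnorm.
    - eapply Rle_lt_trans; [apply Rplus_le_compat_r, Req_le, Hnorm|].
      change (Cmod (u s0 - w)%C + M * (s - s0) < r). nra. }
  replace (u s - w)%C with ((u s - u s0) + (u s0 - w))%C by ring.
  eapply Rle_lt_trans; [apply Cmod_triangle|]. nra.
Qed.

Lemma solution_restrict z tau u e : 0 < e -> Rbar_le e tau ->
  solution Omega G z tau u -> solution Omega G z e u.
Proof.
  intros He Hle [_ [H0 H]]. split; [exact He|]. split; [exact H0|].
  intros t Ht Hte. apply H; [exact Ht|]. eapply Rbar_lt_le_trans; [exact Hte|exact Hle].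
Qed.

Lemma solution_concat z (b e : R) u w v : 0 < b ->
  solution Omega G z b u -> Omega w ->
  (forall eps, 0 < eps -> exists d, 0 < d /\ forall s, b - d < s < b -> Cmod (u s - w)%C < eps) ->
  solution Omega G w e v ->
  solution Omega G z (b + e) (fun s => if Rlt_dec s b then u s else v (s - b)).
Proof.
  intros Hb Hu Hw Hlim Hv.
  assert (He : 0 < e) by apply Hv.
  assert (Hv0 : v 0 = w) by apply Hv.
  set (c := fun s => if Rlt_dec s b then u s else v (s - b)).
  assert (Hcu : forall s, s < b -> c s = u s).
  { intros s Hs. unfold c. destruct (Rlt_dec s b); [reflexivity|lra]. }
  assert (Hcv : forall s, b <= s -> c s = v (s - b)).
  { intros s Hs. unfold c. destruct (Rlt_dec s b); [lra|reflexivity]. }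
  assert (Hcb : c b = w) by (rewrite Hcv, Rminus_diag; [exact Hv0|lra]).
  (* the pieces give the equation away from [b], and is_derive_extend at [b] *)
  assert (Hd : forall s, 0 < s < b + e -> s <> b -> is_derive (V := C_R_NormedModule) c s (G (c s))).
  { intros s Hs Hsb. destruct (Rlt_dec s b) as [Hlt|Hge].
    - rewrite Hcu by exact Hlt.
      apply (is_derive_ext_loc u); [|apply (solution_is_derive z b u s Hu); [lra|exact Hlt]].
      exists (mkposreal (b - s) ltac:(lra)). intros r Hr. change (Rabs (r - s) < b - s) in Hr.
      apply Rabs_def2 in Hr. symmetry. apply Hcu. lra.
    - rewrite Hcv by lra.
      apply (is_derive_ext_loc (fun r => v (r - b))).
      + exists (mkposreal (s - b) ltac:(lra)). intros r Hr. change (Rabs (r - s) < s - b) in Hr.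
        apply Rabs_def2 in Hr. symmetry. apply Hcv. lra.
      + assert (Hshift : is_derive (fun r => r - b) s 1) by (auto_derive; [exact I|ring]).
        assert (H := is_derive_comp (V := C_R_NormedModule) v (fun r => r - b) s _ 1
          (solution_is_derive w e v (s - b) Hv ltac:(lra) ltac:(simpl; lra)) Hshift).
        change (is_derive (V := C_R_NormedModule) (fun r => v (r - b)) s
          (@scal R_Ring C_R_ModuleSpace one (G (v (s - b))))) in H.
        rewrite (scal_one (V := C_R_ModuleSpace)) in H. exact H. }
  assert (Hcont_b : continuous c b).
  { apply filterlim_C_iff. intros eps. rewrite Hcb.
    destruct (Hlim eps (cond_pos eps)) as [d1 [Hd1 H1]].
    destruct (proj1 (filterlim_C_iff _ _) (solution_continuous w e v 0 Hv (Rle_refl 0) He) eps)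
      as [d2 H2].
    exists (mkposreal _ (Rmin_pos _ _ Hd1 (cond_pos d2))). intros r Hr.
    change (Rabs (r - b) < Rmin d1 d2) in Hr.
    assert (Hm1 := Rmin_l d1 d2). assert (Hm2 := Rmin_r d1 d2).
    apply Rabs_def2 in Hr. destruct (Rlt_dec r b) as [Hlt|Hge].
    - rewrite Hcu by exact Hlt. apply H1. lra.
    - rewrite Hcv by lra.
      specialize (H2 (r - b)). rewrite Rabs_R0, Hv0, Rabs_pos_eq in H2 by lra.
      apply H2. change (Rabs (r - b - 0) < d2). rewrite Rminus_0_r, Rabs_pos_eq; lra. }
  assert (Hnear : locally b (fun s => 0 < s < b + e)).
  { exists (mkposreal _ (Rmin_pos _ _ Hb He)). intros s Hs. change (Rabs (s - b) < Rmin b e) in Hs.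
    assert (Hm1 := Rmin_l b e). assert (Hm2 := Rmin_r b e). apply Rabs_def2 in Hs. lra. }
  assert (Hdb : is_derive (V := C_R_NormedModule) c b (G (c b))).
  { apply (is_derive_extend (V := C_R_NormedModule) c (fun s => G (c s)) b).
    - revert Hnear. apply filter_imp. intros s Hs. destruct (Req_dec s b) as [->|Hne]; [exact Hcont_b|].
      apply (ex_derive_continuous (V := C_R_NormedModule)). exists (G (c s)). apply Hd; assumption.
    - revert Hnear. apply filter_imp. intros s Hs. apply Hd, Hs.
    - apply (filterlim_comp _ _ _ c G _ _ _ Hcont_b). apply ex_C_derive_continuous, G_holomorphic.
      rewrite Hcb. exact Hw. }
  split; [simpl; lra|]. split; [rewrite Hcu by exact Hb; apply Hu|].
  intros t Ht Hte. simpl in Hte. split.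
  - destruct (Rlt_dec t b) as [Hlt|Hge].
    + rewrite Hcu by exact Hlt. apply Hu; [exact Ht|exact Hlt].
    + rewrite Hcv by lra. apply Hv; [lra|simpl; lra].
  - assert (Hproper := within_nonneg_proper t Ht).
    destruct (Req_dec t 0) as [->|Ht0].
    + rewrite Hcu by exact Hb.
      apply (filterdiff_ext_loc (U := R_NormedModule) (V := C_R_NormedModule) u c).
      * apply filter_le_within. exists (mkposreal b Hb). intros r Hr. change (Rabs (r - 0) < b) in Hr.
        apply Rabs_def2 in Hr. symmetry. apply Hcu. lra.
      * intros x Hx. apply within_nonneg_lim_unique in Hx; [|lra]. subst x. symmetry. apply Hcu, Hb.
      * apply Hu; [lra|exact Hb].
    + apply (filterdiff_locally (U := R_NormedModule) (V := C_R_NormedModule) c t).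
      * apply within_nonneg_lim.
      * destruct (Req_dec t b) as [->|Htb]; [exact Hdb|]. apply Hd; lra.
Qed.

(** Pasting at the cluster point prolongs the solution by some [e > 0], whatever
    the lifetime of [v], against maximality. *)
Lemma maximal_solution_no_limit z (b : R) u w tau' v :
  maximal_solution Omega G z b u -> Omega w -> solution Omega G w tau' v ->
  ~ (forall e, 0 < e -> exists s, b - e < s < b /\ Cmod (u s - w)%C < e).
Proof.
  intros [Hu Hmax] Hw Hv Hcl.
  assert (Hb : 0 < b) by apply Hu.
  assert (He : exists e, 0 < e /\ Rbar_le e tau').
  { destruct Hv as [H _]. destruct tau' as [e| |]; [exists e|exists 1|destruct H].
    - split; [exact H|apply Rle_refl].
    - split; [lra|exact I]. }
  destruct He as [e [He Hle]].
  assert (Hc := solution_concat z b e u w v Hb Hu Hw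
    (solution_tends_to_cluster_point z b u w Hb Hu Hw Hcl) (solution_restrict w tau' v e He Hle Hv)).
  apply Hmax in Hc.
  - injection Hc. lra.
  - simpl. lra.
  - intros t Ht Htb. destruct (Rlt_dec t b) as [_|H]; [reflexivity|elim H; exact Htb].
Qed.

End Flow.

(** * The semigroup as composition with the flow *)

Section CompositionSemigroup.

Context (Omega : C -> Prop) (Omega_open : open Omega)
  (X : CompleteNormedModule C_AbsRing) (ev : X -> C -> C)
  (HX : banach_of_holomorphic Omega X ev)
  (G : C -> C) (T : R -> X -> X) (HT : C0_semigroup T)
  (HG : forall f g, generator_lim T f g -> eq_G_derive Omega G (ev f) (ev g)).

Let XR := real_CompleteNormedModule X.

Lemma real_semigroup_linear t : 0 <= t -> @is_linear R_AbsRing XR XR (T t).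
Proof. intros Ht. apply real_is_linear_endomorphism, (C0_bounded_linear T HT), Ht. Qed.

Lemma real_semigroup_continuous (f : XR) :
  @filterlim R XR (fun t => T t f) (at_right 0) (locally f).
Proof. exact (C0_continuous T HT f). Qed.

(** The function [s |-> (T (t - s) f) (u s)] is constant, as the transport equation
    is the cancellation of the two terms of its derivative.  Absolute values extend
    the curves beyond the end points, where only continuity is used. *)
Lemma semigroup_eq_composition_on_domain z tau u (f g : X) t :
  solution Omega G z tau u -> generator_lim T f g ->
  0 <= t -> Rbar_lt t tau -> ev (T t f) z = ev f (u t).
Proof.
  intros Hu Hfg Ht Htau.
  assert (Hlt : forall s, s <= t -> Rbar_lt s tau).
  { intros s Hs. eapply Rbar_le_lt_trans; [|exact Htau]. exact Hs. }
  assert (HO : forall s, 0 <= s <= t -> Omega (u (Rabs s))).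
  { intros s Hs. rewrite Rabs_pos_eq by lra. apply Hu; [lra|apply Hlt; lra]. }
  pose (h := fun s => ev (T (Rabs (t - s)) f) (u (Rabs s))).
  assert (H : h t = h 0).
  { apply (constant_of_is_derive_zero (V := C_R_NormedModule)); [exact Ht| |].
    - intros s Hs.
      apply (evaluation_jointly_continuous Omega Omega_open X ev HX
        (fun s => T (Rabs (t - s)) f) (fun s => u (Rabs s))).
      + apply HO, Hs.
      + apply (continuous_comp (fun s => t - s) (fun s => T (Rabs s) f : XR)).
        * apply (continuous_minus (V := R_NormedModule)); [apply continuous_const|apply continuous_id].
        * apply (orbit_continuous (V := XR) T real_semigroup_linear
            (C0_zero T HT) (C0_plus T HT) real_semigroup_continuous).
      + apply (solution_continuous Omega G z tau); [exact Hu|lra|apply Hlt; lra].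
    - intros s Hs.
      assert (Hx : is_derive (V := XR) (fun r => T (Rabs (t - r)) f) s (opp (T (t - s) g))).
      { apply (is_derive_shift_back (V := XR) (fun r => T (Rabs r) f)).
        apply (is_derive_orbit (V := XR) T real_semigroup_linear
            (C0_zero T HT) (C0_plus T HT) real_semigroup_continuous); [lra|exact Hfg]. }
      assert (Hus : is_derive (V := C_R_NormedModule) (fun r => u (Rabs r)) s (G (u s))).
      { apply (is_derive_ext_loc u).
        - exists (mkposreal s (proj1 Hs)). intros r Hr. change (Rabs (r - s) < s) in Hr.
          apply Rabs_def2 in Hr. rewrite Rabs_pos_eq by lra. reflexivity.
        - apply (solution_is_derive Omega G z tau); [exact Hu|lra|apply Hlt; lra]. }
      assert (Hh := evaluation_product_rule Omega Omega_open X ev HX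
        (fun r => T (Rabs (t - r)) f) (fun r => u (Rabs r)) s _ _ (HO s ltac:(lra)) Hx Hus).
      assert (Hgen : generator_lim T (T (t - s) f) (T (t - s) g)).
      { apply (has_generator_value_orbit (V := XR) T real_semigroup_linear (C0_plus T HT));
          [lra|exact Hfg]. }
      assert (HOs := HO s ltac:(lra)). rewrite (Rabs_pos_eq s) in HOs by lra.
      assert (Heq := HG _ _ Hgen (u s) HOs).
      cbv beta in Hh. rewrite (Rabs_pos_eq s), (Rabs_pos_eq (t - s)) in Hh by lra.
      rewrite <- Heq in Hh.
      assert (Hopp : ev (@opp XR (T (t - s) g)) (u s) = (- ev (T (t - s) g) (u s))%C).
      { exact (linear_opp _ _ (evaluation_linear Omega X ev HX (u s) HOs)). }
      assert (Hcancel : (ev (@opp XR (T (t - s) g)) (u s) + ev (T (t - s) g) (u s))%C = 0%C)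
        by (rewrite Hopp; ring).
      exact (eq_ind _ (fun l => is_derive (V := C_R_NormedModule) h s l) Hh _ Hcancel). }
  unfold h in H. rewrite Rminus_diag, Rminus_0_r, Rabs_R0, (C0_zero T HT), Rabs_pos_eq in H by easy.
  assert (Hz : u 0 = z) by apply Hu. rewrite Hz in H. symmetry. exact H.
Qed.

Lemma semigroup_eq_composition z tau u t :
  solution Omega G z tau u -> 0 <= t -> Rbar_lt t tau ->
  forall f, ev (T t f) z = ev f (u t).
Proof.
  intros Hu Ht Htau.
  assert (Hz : Omega z).
  { assert (Hu' := Hu). destruct Hu' as [H0 [<- H]]. apply H; [lra|exact H0]. }
  assert (Hut : Omega (u t)) by (apply Hu; assumption).
  apply (linear_eq_of_eq_on_domain (V := XR) T real_semigroup_linear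
    (C0_zero T HT) (C0_plus T HT) real_semigroup_continuous (W := C_R_NormedModule)
    (fun f => ev (T t f) z) (fun f => ev f (u t))).
  - apply (is_linear_comp (U := XR) (V := XR) (T t) (fun f => ev f z)).
    + apply real_semigroup_linear, Ht.
    + apply (evaluation_linear Omega X ev HX), Hz.
  - apply (evaluation_linear Omega X ev HX), Hut.
  - intros f g Hfg. apply (semigroup_eq_composition_on_domain z tau u f g); assumption.
Qed.

Lemma evaluation_orbit_continuous_at f z t : 0 <= t -> Omega z ->
  forall (s : nat -> R), (forall n, 0 <= s n) -> filterlim s eventually (locally t) ->
  filterlim (fun n => ev (T (s n) f) z) eventually (locally (ev (T t f) z)).
Proof.
  intros Ht Hz s Hs Hst.
  assert (H := filterlim_comp _ _ _ _ _ _ _ _ Hst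
    (orbit_continuous (V := XR) T real_semigroup_linear
      (C0_zero T HT) (C0_plus T HT) real_semigroup_continuous f t)).
  assert (H' := filterlim_comp _ _ _ _ _ _ _ _ H
    (linear_cont (U := XR) _ _ (evaluation_linear Omega X ev HX z Hz))).
  rewrite (Rabs_pos_eq t Ht) in H'. revert H'. apply filterlim_ext.
  intros n. rewrite Rabs_pos_eq; [reflexivity|apply Hs].
Qed.

(** A finite lifetime [b] produces, through the evaluation condition, a cluster
    point of the solution inside [Omega]: along times tending to [b] all functions
    of [X] converge, since their values are values of a continuous orbit of [T]. *)
Lemma maximal_solution_global (HE : evaluation_condition Omega ev)
  (G_holomorphic : holomorphic Omega G) z tau u :
  (forall w, Omega w -> exists tau' v, solution Omega G w tau' v) ->
  maximal_solution Omega G z tau u -> tau = p_infty.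
Proof.
  intros Hex Hu. assert (Hsol := proj1 Hu).
  assert (Hz : Omega z).
  { destruct Hsol as [H0 [<- H]]. apply H; [lra|exact H0]. }
  destruct tau as [b| |]; [exfalso|reflexivity|destruct Hsol as [H0 _]; destruct H0].
  assert (Hb : 0 < b) by apply Hsol.
  pose (s := fun n => b - b * / (INR n + 1)).
  assert (Hinv : forall n, 0 < / (INR n + 1) <= 1).
  { intros n. split; [apply RinvN_pos|]. rewrite <- Rinv_1. assert (H := pos_INR n).
    apply Rinv_le_contravar; lra. }
  assert (Hs : forall n, 0 <= s n < b).
  { intros n. unfold s. specialize (Hinv n). nra. }
  assert (Hsb : filterlim s eventually (locally b)).
  { assert (Hlim : is_lim_seq s b); [|exact Hlim].
    replace (Finite b) with (Finite (b - b * 0)) by (f_equal; ring).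
    apply is_lim_seq_minus'; [apply is_lim_seq_const|].
    apply (is_lim_seq_scal_l _ b 0).
    apply (is_lim_seq_ext (fun n => / INR (S n))).
    { intros n. rewrite S_INR. reflexivity. }
    apply (is_lim_seq_incr_1 (fun n => / INR n)).
    apply (is_lim_seq_inv INR p_infty); [apply is_lim_seq_INR|discriminate]. }
  destruct (sphere_subsequence (fun n => u (s n))) as [k [Hk [zeta Hzeta]]].
  assert (Hkb := filterlim_comp _ _ _ _ _ _ _ _ (filterlim_of_ge_id k Hk) Hsb).
  assert (HO : forall n, Omega (u (s (k n)))).
  { intros n. apply Hsol; apply Hs. }
  destruct (HE (fun n => u (s (k n))) zeta HO (sphere_lim_closure Omega _ zeta HO Hzeta) Hzeta)
    as [w [-> Hw]].
  { intros f. exists (ev (T b f) z).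
    apply (filterlim_ext (fun n => ev (T (s (k n)) f) z)).
    - intros n. apply (semigroup_eq_composition z b u); [exact Hsol|apply Hs|apply Hs].
    - apply evaluation_orbit_continuous_at; [lra|exact Hz|intros n; apply Hs|exact Hkb]. }
  destruct (Hex w Hw) as [tau' [v Hv]].
  apply (maximal_solution_no_limit Omega G G_holomorphic z b u w tau' v Hu Hw Hv).
  intros e He.
  destruct (filter_and _ _ (proj1 (filterlim_C_iff _ _) Hzeta (mkposreal e He))
    (proj1 (filterlim_locally _ _) Hkb (mkposreal e He))) as [N HN].
  destruct (HN N (le_n N)) as [H1 H2]. exists (s (k N)).
  change (Rabs (s (k N) - b) < e) in H2. apply Rabs_def2 in H2.
  assert (H3 := Hs (k N)). split; [lra|exact H1].
Qed.

(** Pointwise in [z], [f (u t) - f z] and the integral of the orbit of [g]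
    evaluated at [z] have the same derivative [g (u s)]. *)
Lemma generator_lim_of_eq_G_derive (f g : X) (u : C -> R -> C) :
  (forall z, Omega z -> solution Omega G z p_infty (u z)) ->
  eq_G_derive Omega G (ev f) (ev g) -> generator_lim T f g.
Proof.
  intros Hu Hfg.
  apply (has_generator_value_iff (V := XR) T real_semigroup_linear
    (C0_zero T HT) (C0_plus T HT) real_semigroup_continuous f g).
  intros t Ht. apply (ev_injective _ _ _ HX). intros z Hz.
  specialize (Hu z Hz). set (v := u z) in *.
  pose (P := fun s => orbit_integral (V := XR) T g s).
  assert (HdP : forall s, is_derive (V := XR) P s (T (Rabs s) g)).
  { intros s. apply (is_derive_orbit_integral (V := XR) T real_semigroup_linear
      (C0_zero T HT) (C0_plus T HT) real_semigroup_continuous). }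
  assert (Hlin := evaluation_linear Omega X ev HX z Hz).
  assert (HO : forall s, 0 <= s -> Omega (v s)) by (intros s Hs; apply Hu; [exact Hs|exact I]).
  pose (h := fun s => minus (G := C_R_NormedModule) (ev f (v (Rabs s))) (ev (P s) z)).
  assert (H : h t = h 0).
  { apply (constant_of_is_derive_zero (V := C_R_NormedModule)); [exact Ht| |].
    - intros s Hs. apply (continuous_minus (V := C_R_NormedModule)).
      + apply (filterlim_comp _ _ _ (fun s => v (Rabs s)) (ev f) _ (locally (v (Rabs s)))).
        * apply (solution_continuous Omega G z p_infty); [exact Hu|lra|exact I].
        * apply (evaluation_continuous Omega X ev HX), HO, Rabs_pos.
      + apply (ex_derive_continuous (V := C_R_NormedModule)). eexists.
        exact (is_derive_linear (V := XR) (W := C_R_NormedModule) _ P s _ Hlin (HdP s)).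
    - intros s Hs.
      assert (H1 : is_derive (V := C_R_NormedModule) (fun s => ev f (v (Rabs s))) s (ev g (v s))).
      { apply (is_derive_ext_loc (fun s => ev f (v s))).
        - exists (mkposreal s (proj1 Hs)). intros r Hr. change (Rabs (r - s) < s) in Hr.
          apply Rabs_def2 in Hr. rewrite Rabs_pos_eq by lra. reflexivity.
        - rewrite (Hfg (v s) (HO s ltac:(lra))). apply is_derive_comp_C.
          + apply (solution_is_derive Omega G z p_infty); [exact Hu|lra|exact I].
          + apply C_derive_correct; [exact 0%C|]. apply (ev_holomorphic _ _ _ HX), HO. lra. }
      assert (H2 := is_derive_linear (V := XR) (W := C_R_NormedModule) _ P s _ Hlin (HdP s)).
      cbv beta in H2. rewrite Rabs_pos_eq in H2 by lra.
      rewrite (semigroup_eq_composition z p_infty v s Hu ltac:(lra) I g) in H2.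
      assert (H3 := is_derive_minus _ _ _ _ _ H1 H2).
      rewrite (minus_eq_zero (G := C_R_NormedModule)) in H3. exact H3. }
  unfold h in H. rewrite Rabs_R0, (Rabs_pos_eq t Ht) in H.
  assert (H0 : ev (P 0) z = (0 : C)).
  { unfold P. rewrite (orbit_integral_zero (V := XR)). exact (linear_zero _ Hlin). }
  assert (Hv0 : v 0 = z) by apply Hu.
  rewrite H0, Hv0 in H.
  etransitivity; [apply (evaluation_minus Omega X ev HX z (T t f) f Hz)|].
  rewrite (semigroup_eq_composition z p_infty v t Hu Ht I f).
  apply (minus_eq_of_minus_eq_minus_zero (V := C_R_NormedModule)), H.
Qed.

End CompositionSemigroup.

Theorem theorem3p2
  (Omega : C -> Prop)
  (Omega_nonempty : exists z, Omega z)
  (Omega_open : open Omega)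
  (Omega_connected : connected Omega)
  (X : CompleteNormedModule C_AbsRing) (ev : X -> C -> C)
  (HX : banach_of_holomorphic Omega X ev)
  (HE : evaluation_condition Omega ev)
  (G : C -> C) (G_holomorphic : holomorphic Omega G)
  (tau : C -> Rbar) (phi : R -> C -> C)
  (Hphi : semiflow_generated Omega G tau phi)
  (T : R -> X -> X) (HT : C0_semigroup T)
  (DA : X -> Prop) (A : X -> X) (HA : is_generator T DA A)
  (HAG : forall f, DA f -> eq_G_derive Omega G (ev f) (ev (A f))) :
  global Omega tau /\
  (forall (f : X) (t : R) (z : C), 0 <= t -> Omega z ->
     ev (T t f) z = ev f (phi t z)) /\
  (forall f, DA f <-> exists g : X, eq_G_derive Omega G (ev f) (ev g)) /\
  (forall f, DA f -> eq_G_derive Omega G (ev f) (ev (A f))).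
Proof.
  destruct HA as [HA1 HA2].
  assert (HG : forall f g, generator_lim T f g -> eq_G_derive Omega G (ev f) (ev g)).
  { intros f g Hfg. assert (Hf : DA f) by (apply HA1; exists g; exact Hfg).
    replace g with (A f); [apply HAG, Hf|].
    exact (filterlim_locally_unique (V := X) (F := at_right 0) _ _ _ (HA2 f Hf) Hfg). }
  assert (Hglobal : global Omega tau).
  { intros z Hz.
    apply (maximal_solution_global Omega Omega_open X ev HX G T HT HG HE G_holomorphic
      z (tau z) (fun t => phi t z)); [|apply Hphi, Hz].
    intros w Hw. exists (tau w), (fun t => phi t w). apply Hphi, Hw. }
  assert (Hsol : forall z, Omega z -> solution Omega G z p_infty (fun t => phi t z)).
  { intros z Hz. rewrite <- (Hglobal z Hz). apply Hphi, Hz. }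
  split; [exact Hglobal|]. split; [|split; [|exact HAG]].
  - intros f t z Ht Hz.
    exact (semigroup_eq_composition Omega Omega_open X ev HX G T HT HG
      z p_infty (fun t => phi t z) t (Hsol z Hz) Ht I f).
  - intros f. split.
    + intros Hf. exists (A f). apply HAG, Hf.
    + intros [g Hg]. apply HA1. exists g.
      exact (generator_lim_of_eq_G_derive Omega Omega_open X ev HX G T HT HG f g
        (fun z t => phi t z) Hsol Hg).
Qed.
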